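(* Given a Vogan diagram with a unique painted node, consider the associated set of simple roots $\Sigma^+=\{\gamma_1,\dots,\gamma_\ell\}$. Assume that the unique painted node corresponds to the simple root $\gamma_p$. Then the fundamental dominant weight $\varphi_p$ is special.
   Context: A Vogan diagram here means a Dynkin diagram with some painted vertices (trivial automorphism). It determines a real semisimple Lie algebra $\mathfrak g$ with Cartan decomposition $\mathfrak g=\mathfrak k\oplus\mathfrak p$, a maximal abelian subalgebra $\mathfrak h_0\subset\mathfrak k$ whose complexification is a Cartan subalgebra of $\mathfrak g_c=\mathfrak g\otimes\mathbf C$, a root system $\Delta$ and a positive system $\Delta^+$ with simple roots $\gamma_1,\dots,\gamma_\ell$ corresponding to the nodes, such that $\gamma_i$ is non-compact exactly when its node is painted. A root $\alpha$ is compact ($\varepsilon_\alpha=-1$) if its root space $\mathfrak g^\alpha$ lies in $\mathfrak k_c$, non-compact ($\varepsilon_\alpha=1$) if it lies in $\mathfrak p_c$. Let $B$ be the Killing form, positive definite on $\mathfrak h_{\mathbf R}=i\mathfrak h_0$; for $\psi\in\mathfrak h_{\mathbf R}^*$, $h_\psi$ satisfies $\psi(h)=B(h_\psi,h)$ on $\mathfrak h_{\mathbf R}$, and $(\psi,\psi')=B(h_\psi,h_{\psi'})$. The fundamental dominant weights are $\varphi_j=\sum_iA^{ij}\gamma_i$, with $(A^{ij})$ the inverse of the Cartan matrix $A_{ij}=2(\gamma_i,\gamma_j)/(\gamma_i,\gamma_i)$. $C=\{\psi:(\psi,\alpha)\ge0\ \forall\alpha\in\Delta^+\}$. Let $G$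 be a connected Lie group with finite center and Lie algebra $\mathfrak g$. For $\varphi\in C$ such that $v=ih_\varphi$ has compact stabilizer $V\subset G$ under the adjoint action, let $\mathfrak m\cong T_e(G/V)$ be the $B$-orthogonal complement of the Lie algebra of $V$. The orbit $G/V$ carries the $G$-invariant Kirillov-Kostant-Souriau symplectic form $\omega$, given at the identity coset by $B(v,[x,y])$, $x,y\in\mathfrak m$. One has $\mathfrak m=\bigoplus\mathfrak m_\alpha$ over $\alpha\in\Delta^+$ with $(\varphi,\alpha)\ne0$, $\mathfrak m_\alpha=(\mathfrak g^\alpha\oplus\mathfrak g^{-\alpha})\cap\mathfrak g$, and the canonical $\omega$-compatible $G$-invariant almost complex structure $J$ acts on $\mathfrak m_\alpha$ by $x\mapsto\frac{\varepsilon_\alpha}{(\varphi,\alpha)}[v,x]$. The Chern connection is the unique affine connection $\nabla$ with $\nabla\omega=0$, $\nabla J=0$ and torsion equal to $N$, where $4N(X,Y)=[JX,JY]-J[JX,Y]-J[X,JY]-[X,Y]$; with curvature $R$, the Chern-Ricci form is $\rho(X,Y)=\mathrm{tr}(JR(X,Y))$. $\varphi$ is called $\lambda$-special (or just special) if $\rho=\lambda\omega$ for a (some) real constant $\lambda$; equivalently $-2\sum_{\alpha\in\Delta^+,\,(\varphi,\alpha)\ne0}\varepsilon_\alpha\alpha=\lambda\varphi$. *)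

(* Defs.v *)
From HB Require Import structures.
From mathcomp Require Import all_boot all_order all_algebra.
From mathcomp Require Import ring.
From mathcomp Require Import boolp classical_sets reals.

Set Implicit Arguments.
Unset Strict Implicit.
Unset Printing Implicit Defensive.

Import Order.TTheory GRing.Theory Num.Theory.
Local Open Scope ring_scope.

HB.mixin Record hasLieBracket (K : fieldType) V of Vector K V := {
  lie : V -> V -> V;
  lie_linearl : forall y, linear (lie^~ y);
  lie_linearr : forall x, linear (lie x);
  liexx : forall x, lie x x = 0;
  lie_jacobi : forall x y z,
    lie x (lie y z) + lie y (lie z x) + lie z (lie x y) = 0
}.

#[short(type="lieAlgType")]
HB.structure Definition LieAlgebra (K : fieldType) :=
  {V of Vector K V & hasLieBracket K V}.

Section LieAlgebra.
Variables (K : fieldType) (g : lieAlgType K).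
Implicit Types (x y z : g) (U V : {vspace g}) (f : g -> g).

HB.instance Definition _ x :=
  GRing.isLinear.Build K g g *:%R (lie x) (lie_linearr x).

Definition ad x : 'End(g) := linfun (lie x).

Lemma adE x y : ad x y = lie x y. Proof. exact: lfunE. Qed.

Lemma lieDl x y z : lie (x + y) z = lie x z + lie y z.
Proof. by have := lie_linearl z 1 x y; rewrite !scale1r. Qed.

Lemma lieZl a x z : lie (a *: x) z = a *: lie x z.
Proof.
have lie0 : lie 0 z = 0.
  by have := lie_linearl z (-1) 0 0; rewrite scaler0 addr0 scaleN1r addNr.
by have := lie_linearl z a x 0; rewrite lie0 !addr0.
Qed.

Lemma lieC x y : lie x y = - lie y x.
Proof.
apply/eqP; rewrite -addr_eq0; apply/eqP.
by have := liexx (x + y); rewrite lieDl !linearD /= !liexx add0r addr0.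
Qed.

Lemma lieDr x y z : lie x (y + z) = lie x y + lie x z.
Proof. exact: linearD. Qed.

Lemma lieNr x y : lie x (- y) = - lie x y.
Proof. exact: linearN. Qed.

(* [U, V]: the span of the brackets *)
Definition lie_prod U V : {vspace g} :=
  <<[seq lie u v | u <- vbasis U, v <- vbasis V]>>%VS.

Definition lie_ideal U := (lie_prod {:g} U <= U)%VS.
Definition lie_subalgebra U := (lie_prod U U <= U)%VS.
Definition lie_abelian U := forall x y, x \in U -> y \in U -> lie x y = 0.

Definition lie_solvable U := exists n, iter n (fun V => lie_prod V V) U = 0%VS.
Definition lie_nilpotent U := exists n, iter n (lie_prod U) U = 0%VS.

Definition lie_semisimple :=
  forall U, lie_ideal U -> lie_solvable U -> U = 0%VS.

Definition self_normalizing U :=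
  forall x, (forall y, y \in U -> lie x y \in U) -> x \in U.

Definition cartan_subalgebra U :=
  [/\ lie_subalgebra U, lie_nilpotent U & self_normalizing U].

(* The trace of the restriction of f to U, for f linear on U with f U <= U *)
Definition trace_on U f : K :=
  \sum_(i < \dim U) coord (vbasis U) i (f (vbasis U)`_i).

Definition killing x y : K := trace_on {:g} (fun z => lie x (lie y z)).

Lemma killing_is_linear x : scalar (killing x).
Proof.
move=> a y z; rewrite /killing /trace_on /= mulr_sumr -big_split /=.
by apply: eq_bigr => i _; rewrite lieDl lieZl !linearD !linearZ.
Qed.

HB.instance Definition _ x :=
  GRing.isLinear.Build K g K *%R (killing x) (killing_is_linear x).

Definition killing_orth U : {vspace g} :=
  (\bigcap_(i < \dim U)
     lker (linfun (killing (vbasis U)`_i : g -> K^o)))%VS.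

Lemma killingDZl a x y z : killing (a *: x + y) z = a * killing x z + killing y z.
Proof.
rewrite /killing /trace_on /= mulr_sumr -big_split /=.
by apply: eq_bigr => i _; rewrite lieDl lieZl !linearD !linearZ.
Qed.

Lemma killing_orthP U x :
  reflect (forall u, u \in U -> killing u x = 0) (x \in killing_orth U).
Proof.
pose f i : 'Hom(g, K^o) := linfun (killing (vbasis U)`_i : g -> K^o).
have fE i y : f i y = killing (vbasis U)`_i y by rewrite lfunE.
have orthE : (x \in killing_orth U) = [forall i : 'I_(\dim U), f i x == 0].
  rewrite memvE; apply/subv_bigcapP/forallP => H i.
    by rewrite -memv_ker memvE; apply: H.
  by move=> _; rewrite -memvE memv_ker; apply: H.
rewrite orthE; apply: (iffP forallP) => [H u uU | H i].
  rewrite (coord_vbasis uU).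
  have: forall s : seq 'I_(\dim U),
      killing (\sum_(i <- s) coord (vbasis U) i u *: (vbasis U)`_i) x = 0.
    elim=> [|i s IH].
      rewrite big_nil; have := killingDZl (-1) 0 0 x.
      by rewrite scaler0 addr0 mulN1r addNr.
    by rewrite big_cons killingDZl IH -fE (eqP (H i)) mulr0 addr0.
  exact.
by rewrite fE H // vbasis_mem // mem_nth // size_tuple.
Qed.

End LieAlgebra.

(* g + i g, as a real Lie algebra, (x, y) standing for x + i y *)
Definition complexification (K : fieldType) (g : lieAlgType K) := (g * g)%type.

Section Complexification.
Variables (K : fieldType) (g : lieAlgType K).

HB.instance Definition _ := Vector.on (complexification g).

Implicit Types (z w : complexification g).

Definition clie z w : complexification g :=
  (lie z.1 w.1 - lie z.2 w.2, lie z.1 w.2 + lie z.2 w.1).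

Fact clie_linearl w : linear (clie^~ w).
Proof.
move=> a z z'; rewrite /clie /=; congr pair; rewrite !lieDl !lieZl.
  by rewrite opprD addrACA -scalerBr.
by rewrite addrACA -scalerDr.
Qed.

Fact clie_linearr z : linear (clie z).
Proof.
move=> a w w'; rewrite /clie /=; congr pair; rewrite !lie_linearr.
  by rewrite opprD addrACA -scalerBr.
by rewrite addrACA -scalerDr.
Qed.

Fact cliexx z : clie z z = 0.
Proof.
by rewrite /clie !liexx subrr [lie z.1 z.2]lieC addNr.
Qed.

Fact clie_jacobi z w u :
  clie z (clie w u) + clie w (clie u z) + clie u (clie z w) = 0.
Proof.
have jac0 (a b c : g) : lie a (lie b c) = - lie b (lie c a) - lie c (lie a b).
  by apply/eqP; rewrite -subr_eq0 opprD !opprK addrA lie_jacobi.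
pose c i (a : g) := coord (vbasis {:g}) i a.
have cD i a b : c i (a + b) = c i a + c i b by exact: linearD.
have cN i a : c i (- a) = - c i a by exact: linearN.
have c_inj (a b : g) : (forall i, c i a = c i b) -> a = b.
  move=> eq_ab; rewrite (coord_vbasis (memvf a)) (coord_vbasis (memvf b)).
  by apply: eq_bigr => i _; congr (_ *: _); apply: eq_ab.
rewrite /clie; congr pair; rewrite /= !(lieDr, lieNr);
  rewrite (jac0 z.1 w.1) (jac0 z.1 w.2) (jac0 z.2 w.1) (jac0 z.2 w.2);
  rewrite -[RHS](subrr z.1); apply: c_inj => i; rewrite !(cD, cN); ring.
Qed.

HB.instance Definition _ := hasLieBracket.Build K (complexification g)
  clie_linearl clie_linearr cliexx clie_jacobi.

Definition cre (x : g) : complexification g := (x, 0).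
Definition cimul z : complexification g := (- z.2, z.1).

Fact cre_linear : linear cre.
Proof. by move=> a x y; congr pair; rewrite /= scaler0 addr0. Qed.

Fact cimul_linear : linear cimul.
Proof. by move=> a z w; congr pair; rewrite /= opprD -scalerN. Qed.

HB.instance Definition _ :=
  GRing.isLinear.Build K g (complexification g) *:%R cre cre_linear.
HB.instance Definition _ :=
  GRing.isLinear.Build K (complexification g) (complexification g) *:%R
    cimul cimul_linear.

Definition ivspace (U : {vspace g}) : {vspace complexification g} :=
  (linfun cimul @: (linfun cre @: U))%VS.
Definition cvspace (U : {vspace g}) : {vspace complexification g} :=
  (linfun cre @: U + ivspace U)%VS.

Lemma mem_ivspace (U : {vspace g}) z :
  (z \in ivspace U) = (z.1 == 0) && (z.2 \in U).
Proof.
apply/idP/andP => [/memv_imgP [w /memv_imgP [x xU ->] ->] | [/eqP z1 z2U]].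
  by rewrite !lfunE /= oppr0 eqxx.
have -> : z = linfun cimul (linfun cre z.2).
  by rewrite !lfunE /= /cimul /= oppr0 -z1; case: (z).
by rewrite !memv_img.
Qed.

Lemma mem_cvspace (U : {vspace g}) z :
  (z \in cvspace U) = (z.1 \in U) && (z.2 \in U).
Proof.
apply/idP/andP => [/memv_addP [w /memv_imgP [x xU ->] [u]] | [z1U z2U]].
  rewrite mem_ivspace => /andP [/eqP u1 u2U] ->.
  by rewrite lfunE /= u1 addr0 add0r.
have -> : z = linfun cre z.1 + ((0, z.2) : complexification g).
  by rewrite lfunE; case: (z) => x y; congr pair; rewrite /= ?addr0 ?add0r.
by rewrite memv_add ?memv_img ?mem_ivspace //= eqxx.
Qed.

(* Real part of the complex bilinear extension of the Killing form of g; for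
   a subspace h0 of g that extension is real valued on i h0. *)
Definition ckilling z w : K := killing z.1 w.1 - killing z.2 w.2.
End Complexification.

Section Structure.
Variables (R : realType) (g : lieAlgType R).
Implicit Types (x y : g) (k p : {vspace g}).

Definition cartan_decomposition k p :=
  [/\ (k + p = {:g})%VS, (k :&: p = 0)%VS,
      [/\ (lie_prod k k <= k)%VS, (lie_prod k p <= p)%VS
        & (lie_prod p p <= k)%VS],
      forall x, x \in k -> x != 0 -> killing x x < 0
    & forall x, x \in p -> x != 0 -> 0 < killing x x].

Definition maximal_abelian_in k (h : {vspace g}) :=
  [/\ (h <= k)%VS, lie_abelian h
    & forall a : {vspace g},
        (a <= k)%VS -> lie_abelian a -> (h <= a)%VS -> a = h].

Variables (k p h0 : {vspace g}).

Notation hR := (ivspace h0).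

(* The roots are real valued on hR = i h0, so they live in the real dual. *)
Definition hdual : vectType R := 'Hom(subvs_of hR, R^o).

Implicit Types (alpha psi phi : hdual).

Definition root_vector alpha (z : complexification g) :=
  forall h : subvs_of hR, lie (vsval h) z = (alpha h : R) *: z.

Definition is_root alpha :=
  alpha != 0 /\ exists2 z, root_vector alpha z & z != 0.

Definition compact_root alpha :=
  is_root alpha /\ forall z, root_vector alpha z -> z \in cvspace k.
Definition noncompact_root alpha :=
  is_root alpha /\ forall z, root_vector alpha z -> z \in cvspace p.

Definition eps alpha : R := if `[< compact_root alpha >] then -1 else 1.

(* h_psi; unique because ckilling is positive definite on hR *)
Definition dual_vector psi : subvs_of hR :=
  xget 0 [set h | forall h', (psi h' : R) = ckilling (vsval h) (vsval h')]%classic.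

Definition ip psi psi' : R :=
  ckilling (vsval (dual_vector psi)) (vsval (dual_vector psi')).

Variables (l : nat) (gam : l.-tuple hdual).

Definition nat_comb (n : 'I_l -> nat) : hdual := \sum_(i < l) tnth gam i *+ n i.

(* gam is a base of the root system, and the positive roots are those with
   nonnegative integral coordinates. *)
Definition simple_roots :=
  [/\ basis_of {:hdual} gam,
      forall i, is_root (tnth gam i)
    & forall alpha, is_root alpha ->
        exists n, alpha = nat_comb n \/ alpha = - nat_comb n].

Definition positive_root alpha :=
  is_root alpha /\ exists n, alpha = nat_comb n.

Definition vogan_painting (painted : {set 'I_l}) :=
  forall i, if i \in painted then noncompact_root (tnth gam i)
            else compact_root (tnth gam i).

Definition cartan_matrix : 'M[R]_l :=
  \matrix_(i, j)
    (2 * ip (tnth gam i) (tnth gam j) / ip (tnth gam i) (tnth gam i)).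

Definition fundamental_weight (j : 'I_l) : hdual :=
  \sum_(i < l) invmx cartan_matrix i j *: tnth gam i.

Definition dominant psi := forall alpha, positive_root alpha -> 0 <= ip psi alpha.

Section Orbit.
Variable phi : hdual.

(* i h_phi, which lies in the real form g *)
Definition orbit_pt : g := (cimul (vsval (dual_vector phi))).1.

(* the Lie algebra of the stabilizer V of orbit_pt *)
Definition stab : {vspace g} := lker (ad orbit_pt).

(* V is compact exactly when its Lie algebra lies in k: V is stable under the
   global Cartan involution, and K is compact because G has finite center. *)
Definition compact_stabilizer := (stab <= k)%VS.

Definition mspace : {vspace g} := killing_orth stab.

Definition pr_m : 'End(g) := daddv_pi mspace stab.
Definition pr_stab : 'End(g) := daddv_pi stab mspace.

(* G-invariant tensors on G/V are given by their values on mspace = T_e(G/V). *)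

Definition omega x y : R := killing orbit_pt (lie x y).

Definition root_plane alpha x :=
  exists z w, [/\ root_vector alpha z, root_vector (- alpha) w & cre x = z + w].

Definition canonical_acs (J : 'End(g)) :=
  forall alpha, positive_root alpha -> ip phi alpha != 0 ->
  forall x, root_plane alpha x ->
    J x = (eps alpha / ip phi alpha) *: lie orbit_pt x.

(* Vector fields on G/V lift to V-equivariant maps G -> mspace, and at the
   identity the bracket of two constant lifts is pr_m (lie x y). *)
Definition nijenhuis (J : 'End(g)) x y : g :=
  4^-1 *: (pr_m (lie (J x) (J y)) - J (pr_m (lie (J x) y))
           - J (pr_m (lie x (J y))) - pr_m (lie x y)).

(* G-invariant affine connections on the reductive space G/V, described as
   bilinear maps (x, y) |-> D x y on mspace equivariant under V (Nomizu); V is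
   connected, so equivariance is stated for its Lie algebra. *)
Definition invariant_connection (D : 'Hom(g, 'End(g))) :=
  (forall x y, x \in mspace -> y \in mspace -> D x y \in mspace) /\
  (forall h x y, h \in stab -> x \in mspace -> y \in mspace ->
     lie h (D x y) = D (lie h x) y + D x (lie h y)).

Definition torsion (D : 'Hom(g, 'End(g))) x y : g :=
  D x y - D y x - pr_m (lie x y).

Definition curvature (D : 'Hom(g, 'End(g))) x y z : g :=
  D x (D y z) - D y (D x z) - D (pr_m (lie x y)) z - lie (pr_stab (lie x y)) z.

Definition chern_connection (J : 'End(g)) (D : 'Hom(g, 'End(g))) :=
  [/\ invariant_connection D,
      forall x y z, x \in mspace -> y \in mspace -> z \in mspace ->
        omega (D x y) z + omega y (D x z) = 0,
      forall x y, x \in mspace -> y \in mspace -> D x (J y) = J (D x y)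
    & forall x y, x \in mspace -> y \in mspace ->
        torsion D x y = nijenhuis J x y].

Definition chern_ricci (J : 'End(g)) (D : 'Hom(g, 'End(g))) x y : R :=
  trace_on mspace (fun z => J (curvature D x y z)).

(* On mspace, J and D are determined by canonical_acs and chern_connection. *)
Definition lambda_special (lambda : R) :=
  [/\ dominant phi, compact_stabilizer
    & exists J D, [/\ canonical_acs J, chern_connection J D
        & forall x y, x \in mspace -> y \in mspace ->
            chern_ricci J D x y = lambda * omega x y]].

Definition special := exists lambda, lambda_special lambda.
End Orbit.

End Structure.

(* Main.v *)
From HB Require Import structures.
From mathcomp Require Import all_boot all_order all_algebra.
From mathcomp Require Import ring lra spectral.
From mathcomp Require Import boolp reals.
From mathcomp Require Import complex.
Require Import Defs.

Set Implicit Arguments.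
Unset Strict Implicit.
Unset Printing Implicit Defensive.

Import Order.TTheory GRing.Theory Num.Theory.
Local Open Scope ring_scope.

(** Let [phi] be the fundamental weight of the painted node and [v = i h_phi]
    the point of the orbit.  The weight [phi] pairs to zero with every simple
    root except the painted one, so up to the positive factor
    [c = (gamma_q, gamma_q) / 2] the operator [ad h_phi] grades the complexified
    Lie algebra by the coefficient [n] of a root along the painted simple root.
    The proof rests on three consequences.

    Parity ([theta_root]).  The Cartan involution acts on a root space of degree
    [n] by [(-1) ^ n].  A root vector violating this, of smallest height, would
    be killed by all the root vectors of the negative simple roots; positivity of
    the Hermitian form attached to the Cartan involution would then make its
    root [alpha] satisfy [(alpha, gamma_i) <= 0] for all [i], hence
    [(alpha, alpha) <= 0] ([ip_lowest_le0]).  So the stabilizer, being of degree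
    0, lies in [k]; and the almost complex structure [J] depends on the degree
    only, which makes it an odd function of [ad v] ([acs_exists]) and hence an
    operator commuting with the stabilizer.

    The Chern-Ricci form depends on [J] only ([chern_ricciE]).  For an invariant
    connection [D] commuting with [J], the functional [w |-> tr (J (D w))] is
    invariant under the stabilizer, hence zero because every tangent vector is a
    bracket with [v].  What survives in the trace of [J] times the curvature is
    [- tr (J (ad s))], where [s] is the stabilizer component of [[x, y]].

    The functional [s |-> tr (J (ad s))] kills the brackets of the stabilizer,
    among which are its root vectors and the vectors [h_(gamma_i)] of all the
    unpainted nodes.  These span the orthogonal of [v] in the stabilizer, so
    the functional is a multiple of [killing v] ([trace_J_stab]), and the
    Chern-Ricci form is the same multiple of [killing v [x, y]], up to sign.

    It remains to exhibit a Chern connection.  In complex terms it is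
    [D_X Y = [X, Y]] projected to type (1,0) when [X] has type (0,1) and [Y] has
    type (1,0), which the torsion forces; the component with both arguments of
    type (1,0) is then determined by duality with respect to the symplectic
    form, and is the projection of [L^-1 [X, L Y]] with [L = ad v].
    [chern_lfun] is this connection written over the reals.

    Throughout, a root vector is a pair [(x, y)] of real elements, its real and
    imaginary parts; on it [t] in [h0] acts by [[t, x] = a y], [[t, y] = - a x].
    Lengths of such vectors are taken for the inner product [cartan_form]. *)

(** * Linear algebra *)

Lemma span_ind (K : fieldType) (V : vectType K) (xs : seq V) (P : V -> Prop) :
    P 0 -> (forall a u v, P u -> P v -> P (a *: u + v)) ->
    (forall x, x \in xs -> P x) ->
  forall x, x \in <<xs>>%VS -> P x.
Proof.
move=> P0 PD Pxs x; rewrite -[xs]/(in_tuple xs : seq V) => /coord_span ->.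
by elim/big_rec: _ => // i y _ Py; apply: PD => //; apply: Pxs; rewrite mem_nth.
Qed.

(** Reduces an identity between vectors to one between scalars, where the
    decision procedures for rings apply. *)
Lemma vect_eqP (K : fieldType) (V : vectType K) (a b : V) :
  (forall f : {scalar V}, f a = f b) -> a = b.
Proof.
move=> ab; rewrite (coord_vbasis (memvf a)) (coord_vbasis (memvf b)).
by apply: eq_bigr => i _; rewrite ab.
Qed.

Lemma scalarD (K : fieldType) (V : vectType K) (f : {scalar V}) a b : f (a + b) = f a + f b.
Proof. exact: linearD. Qed.

Lemma scalarN (K : fieldType) (V : vectType K) (f : {scalar V}) a : f (- a) = - f a.
Proof. exact: linearN. Qed.

Lemma scalarZ (K : fieldType) (V : vectType K) (f : {scalar V}) c a : f (c *: a) = c * f a.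
Proof. exact: linearZ. Qed.

Lemma lfunD (K : fieldType) (V W : vectType K) (f : 'Hom(V, W)) a b : f (a + b) = f a + f b.
Proof. exact: linearD. Qed.

Lemma lfunN (K : fieldType) (V W : vectType K) (f : 'Hom(V, W)) a : f (- a) = - f a.
Proof. exact: linearN. Qed.

Section PolynomialCalculus.
Variables (K : fieldType) (V : vectType K).
Implicit Types (f T : 'End(V)) (p : {poly K}) (x y : V).

Definition poly_end f p : 'End(V) :=
  \sum_(i < size p) p`_i *: iter i (fun h => (f \o h)%VF) \1%VF.

Lemma poly_endE f p x : poly_end f p x = \sum_(i < size p) p`_i *: iter i f x.
Proof.
rewrite sum_lfunE; apply: eq_bigr => i _; rewrite scale_lfunE; congr (_ *: _).
by elim: (nat_of_ord i) => [|n IHn] /=; rewrite ?id_lfunE // comp_lfunE IHn.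
Qed.

Lemma poly_end_eigen f p a x : f x = a *: x -> poly_end f p x = p.[a] *: x.
Proof.
move=> fx; rewrite poly_endE horner_coef scaler_suml; apply: eq_bigr => i _.
rewrite -scalerA; congr (_ *: _).
elim: (nat_of_ord i) => [|n IHn] /=; first by rewrite expr0 scale1r.
by rewrite IHn linearZ /= fx scalerA exprSr.
Qed.

Lemma poly_end_comm f p T x :
  (forall y, T (f y) = f (T y)) -> T (poly_end f p x) = poly_end f p (T x).
Proof.
move=> Tf; rewrite !poly_endE linear_sum; apply: eq_bigr => i _.
rewrite linearZ /=; congr (_ *: _).
by elim: (nat_of_ord i) => [|n IHn] //=; rewrite Tf IHn.
Qed.

(** Newton interpolation, adding one node at a time. *)
Lemma interpolation (a b : nat -> K) N : injective a ->
  exists p : {poly K}, forall n, (n < N)%N -> p.[a n] = b n.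
Proof.
move=> a_inj; elim: N => [|N [p pE]]; first by exists 0.
pose r := \prod_(i < N) ('X - (a i)%:P).
have rN n : (n < N)%N -> r.[a n] = 0.
  move=> nN; rewrite horner_prod (bigD1 (Ordinal nN)) //= !hornerE subrr mul0r //.
have rN0 : r.[a N] != 0.
  rewrite horner_prod; apply/prodf_neq0 => i _; rewrite !hornerE subr_eq0.
  by rewrite (inj_eq a_inj) gtn_eqF.
exists (p + ((b N - p.[a N]) / r.[a N]) *: r) => n.
rewrite ltnS leq_eqVlt => /orP[/eqP->|nN]; rewrite !hornerE.
  by rewrite divfK // addrC subrK.
by rewrite (rN n nN) mulr0 addr0 pE.
Qed.

End PolynomialCalculus.

(** A common eigenvector [x + i y] of the complexified operators, with the
    eigenvalues [a + i b], read off in real terms. *)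
Lemma joint_eigenpair (R : rcfType) (V : vectType R) (U : {vspace V}) (n : nat)
    (f : 'I_n -> {linear V -> V}) :
    U != 0%VS ->
    (forall i x, x \in U -> f i x \in U) ->
    (forall i j x, x \in U -> f i (f j x) = f j (f i x)) ->
  exists x y, [/\ x \in U, y \in U, x != 0 &
    forall i, exists a b, f i x = a *: x - b *: y /\ f i y = a *: y + b *: x].
Proof.
move=> U0 fU fC; pose d := \dim U; pose e := vbasis U.
have eU c : e`_(nat_of_ord (c : 'I_d)) \in U by rewrite vbasis_mem ?mem_nth ?size_tuple.
pose M i : 'M[R]_d := \matrix_(r, c) coord e c (f i e`_r).
have fe i r : f i e`_(nat_of_ord (r : 'I_d)) = \sum_c M i r c *: e`_c.
  by rewrite (coord_vbasis (fU i _ (eU r))); apply: eq_bigr => c _; rewrite mxE.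
have MC i j : M i *m M j = M j *m M i.
  have MM i' j' r c : (M i' *m M j') r c = coord e c (f j' (f i' e`_r)).
    rewrite fe !linear_sum mxE; apply: eq_bigr => c' _.
    by rewrite !linearZ /= [M j' _ _]mxE.
  by apply/matrixP => r c; rewrite !MM fC.
pose A i := map_mx (real_complex R) (M i).
have [|A1 A2|w w0 wA] := @common_eigenvector R[i] d [seq A i | i : 'I_n].
- by rewrite lt0n dimv_eq0.
- case/codomP=> i -> /codomP [j ->].
  by rewrite /comm_mx -!map_mxM MC.
have wE i : exists l : R[i], w *m A i = l *: w.
  by apply/sub_rVP; apply: (allP wA); apply: codom_f.
pose x0 := \sum_c complex.Re (w 0 c) *: e`_c.
pose y0 := \sum_c complex.Im (w 0 c) *: e`_c.
have x0U : x0 \in U by apply: memv_suml => c _; rewrite memvZ.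
have y0U : y0 \in U by apply: memv_suml => c _; rewrite memvZ.
have ReD : {morph @complex.Re R : x y / x + y >-> x + y} by case=> ? ? [].
have ImD : {morph @complex.Im R : x y / x + y >-> x + y} by case=> ? ? [].
have push i (u : 'I_d -> R) : f i (\sum_c u c *: e`_c) =
    \sum_c (\sum_r u r * M i r c) *: e`_c.
  rewrite linear_sum; under eq_bigr do rewrite linearZ /= fe scaler_sumr.
  rewrite exchange_big; apply: eq_bigr => c _ /=.
  by rewrite scaler_suml; apply: eq_bigr => r _; rewrite scalerA.
have key i : exists a b, f i x0 = a *: x0 - b *: y0 /\ f i y0 = a *: y0 + b *: x0.
  have [[a b] wAi] := wE i; exists a, b.
  have wM c : \sum_r w 0 r * (M i r c)%:C%C = Complex a b * w 0 c.
    have := congr1 (fun B : 'rV_d => B 0 c) wAi; rewrite !mxE => <-.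
    by apply: eq_bigr => r _; rewrite !mxE.
  split; rewrite push !scaler_sumr -?sumrB -?big_split /=; apply: eq_bigr => c _;
    rewrite !scalerA -?scalerBl -?scalerDl; congr (_ *: _).
  - have := congr1 (@complex.Re R) (wM c); rewrite (big_morph _ ReD erefl).
    case: (w 0 c) => u v /= <-; apply: eq_bigr => r _.
    by case: (w 0 r) => ? ? /=; rewrite mulr0 subr0.
  - have := congr1 (@complex.Im R) (wM c); rewrite (big_morph _ ImD erefl).
    case: (w 0 c) => u v /= <-; apply: eq_bigr => r _.
    by case: (w 0 r) => ? ? /=; rewrite mulr0 add0r.
have [x00|x00] := eqVneq x0 0; last by exists x0, y0.
exists y0, (- x0); split; rewrite ?memvN //; last first.
  move=> i; have [a [b [fx fy]]] := key i; exists a, b.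
  by rewrite !scalerN opprK linearN fx fy opprB; split=> //; rewrite addrC.
apply: contraNneq w0 => y00; apply/eqP/rowP => c; rewrite mxE.
have /freeP fre : free e := basis_free (vbasisP U).
have Re0 := fre (fun c => complex.Re (w 0 c)) x00 c.
have Im0 := fre (fun c => complex.Im (w 0 c)) y00 c.
by move: Re0 Im0; case: (w 0 c) => u v /= -> ->.
Qed.

(** * Traces and the Killing form *)

Section Traces.
Variables (K : fieldType) (g : lieAlgType K).
Implicit Types (x y z : g) (U : {vspace g}).

Lemma eq_trace_on U (f h : g -> g) :
  {in U, f =1 h} -> trace_on U f = trace_on U h.
Proof.
move=> fh; apply: eq_bigr => i _; congr (coord _ _ _); apply: fh.
by rewrite vbasis_mem ?mem_nth ?size_tuple.
Qed.

Lemma trace_onD U (f h : g -> g) :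
  trace_on U (fun x => f x + h x) = trace_on U f + trace_on U h.
Proof. by rewrite /trace_on -big_split; apply: eq_bigr => i _; rewrite linearD. Qed.

Lemma trace_onZ U a (f : g -> g) :
  trace_on U (fun x => a *: f x) = a * trace_on U f.
Proof. by rewrite /trace_on mulr_sumr; apply: eq_bigr => i _; rewrite linearZ. Qed.

Lemma trace_onN U (f : g -> g) : trace_on U (fun x => - f x) = - trace_on U f.
Proof. by rewrite /trace_on -sumrN; apply: eq_bigr => i _; rewrite linearN. Qed.

(** The right-hand side is symmetric in the two maps, up to exchanging the
    indices, whence the cyclicity of the trace below. *)
Lemma trace_on_comp U (f : {linear g -> g}) (h : g -> g) :
  (forall x, x \in U -> h x \in U) ->
  trace_on U (f \o h) = \sum_(i < \dim U) \sum_(j < \dim U)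
    coord (vbasis U) j (h (vbasis U)`_i) * coord (vbasis U) i (f (vbasis U)`_j).
Proof.
move=> hU; apply: eq_bigr => i _ /=.
have bU : (vbasis U)`_i \in U by rewrite vbasis_mem ?mem_nth ?size_tuple.
rewrite {1}(coord_vbasis (hU _ bU)) !linear_sum /=.
by apply: eq_bigr => j _; rewrite !linearZ.
Qed.

Lemma trace_onC U (f h : {linear g -> g}) :
  (forall x, x \in U -> f x \in U) -> (forall x, x \in U -> h x \in U) ->
  trace_on U (f \o h) = trace_on U (h \o f).
Proof.
move=> fU hU; rewrite !trace_on_comp // exchange_big /=.
by apply: eq_bigr => i _; apply: eq_bigr => j _; rewrite mulrC.
Qed.

End Traces.

Section Killing.
Variables (K : fieldType) (g : lieAlgType K).
Implicit Types (x y z : g) (U : {vspace g}).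

Lemma lie0l x : lie 0 x = 0.
Proof. by rewrite -{1}(scale0r (0 : g)) lieZl scale0r. Qed.

Lemma lieNl x y : lie (- x) y = - lie x y.
Proof. by rewrite -scaleN1r lieZl scaleN1r. Qed.

Lemma lie_derivation x y z : lie x (lie y z) = lie (lie x y) z + lie y (lie x z).
Proof.
have /eqP := lie_jacobi x y z.
rewrite [lie z x]lieC [lie z (lie x y)]lieC lieNr -addrA -opprD subr_eq0 addrC.
by move=> /eqP.
Qed.

Lemma lie_lieE x y z : lie (lie x y) z = lie x (lie y z) - lie y (lie x z).
Proof. by rewrite lie_derivation addrK. Qed.

Lemma killingC x y : killing x y = killing y x.
Proof. by apply: (trace_onC (f := lie x) (h := lie y)) => *; apply: memvf. Qed.

Lemma killing_lie x y z : killing (lie x y) z = killing x (lie y z).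
Proof.
transitivity (trace_on fullv (fun w => lie x (lie y (lie z w)))
              - trace_on fullv (fun w => lie y (lie x (lie z w)))).
  rewrite -trace_onN -trace_onD; apply: eq_trace_on => w _.
  by rewrite lie_lieE.
have -> : trace_on fullv (fun w => lie y (lie x (lie z w)))
        = trace_on fullv (fun w => lie x (lie z (lie y w))).
  by apply: (trace_onC (f := lie y) (h := lie x \o lie z)) => *; apply: memvf.
rewrite -trace_onN -trace_onD; apply: eq_trace_on => w _.
by rewrite lie_lieE lieDr lieNr.
Qed.

Lemma killingNr x y : killing x (- y) = - killing x y.
Proof. exact: linearN. Qed.

Lemma killingDr x y z : killing x (y + z) = killing x y + killing x z.
Proof. exact: linearD. Qed.

Lemma killingBr x y z : killing x (y - z) = killing x y - killing x z.
Proof. exact: linearB. Qed.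

Lemma killingZr a x y : killing x (a *: y) = a * killing x y.
Proof. exact: linearZ. Qed.

Lemma killing0r x : killing x 0 = 0.
Proof. exact: linear0. Qed.

Lemma killing0l x : killing 0 x = 0.
Proof. by rewrite killingC killing0r. Qed.

Lemma killingNl x y : killing (- x) y = - killing x y.
Proof. by rewrite killingC killingNr killingC. Qed.

Lemma killingDl x y z : killing (x + y) z = killing x z + killing y z.
Proof. by rewrite killingC killingDr ![killing z _]killingC. Qed.

Lemma killingZl a x y : killing (a *: x) y = a * killing x y.
Proof. by rewrite killingC killingZr killingC. Qed.

Lemma killing_skew x y z : killing (lie x y) z = - killing y (lie x z).
Proof. by rewrite lieC killingNl killing_lie. Qed.

End Killing.

(** * The Cartan involution *)

Section CartanInvolution.
Variables (R : realType) (g : lieAlgType R) (k p : {vspace g}).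
Implicit Types (x y z u : g) (U V : {vspace g}).

Lemma memv_lie_prod U V x y : x \in U -> y \in V -> lie x y \in lie_prod U V.
Proof.
move=> xU yV; rewrite (coord_vbasis xU) (coord_vbasis yV).
rewrite linear_sum /=; apply: memv_suml => j _; rewrite linearZ /=; apply: memvZ.
rewrite lieC linear_sum /= memvN; apply: memv_suml => i _; rewrite linearZ /= memvZ //.
rewrite lieC memvN memv_span //; apply/allpairsP.
exists ((vbasis U)`_i, (vbasis V)`_j) => //=; split=> //;
  by rewrite mem_nth ?size_tuple.
Qed.

Definition cartan_inv : 'End(g) := daddv_pi k p - daddv_pi p k.
Local Notation theta := cartan_inv.

(** The inner product [B_theta] attached to the Cartan involution: invariance of
    the Killing form makes [- ad (theta u)] the adjoint of [ad u]. *)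
Definition cartan_form x y : R := - killing x (theta y).
Local Notation s := cartan_form.

Hypothesis cd : cartan_decomposition k p.

Lemma cartan_capkp : (k :&: p = 0)%VS. Proof. by case: cd. Qed.
Lemma cartan_cappk : (p :&: k = 0)%VS. Proof. by rewrite capvC cartan_capkp. Qed.

Lemma cartan_split x : exists a b, [/\ a \in k, b \in p & x = a + b].
Proof.
have : x \in (k + p)%VS by case: cd => -> *; apply: memvf.
by case/memv_addP => a ak [b bp ->]; exists a, b.
Qed.

Lemma daddv_pi_other U V x : (U :&: V = 0)%VS -> x \in V -> daddv_pi U V x = 0.
Proof.
move=> UV xV; have xUV : x \in (U + V)%VS by rewrite (subvP (addvSr _ _)).
have := daddv_pi_add UV xUV; rewrite (daddv_pi_id _ xV); last by rewrite capvC.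
by move/(canRL (addrK _)); rewrite subrr.
Qed.

Lemma cartan_inv_k x : x \in k -> theta x = x.
Proof.
move=> xk; rewrite add_lfunE opp_lfunE daddv_pi_id ?cartan_capkp //.
by rewrite daddv_pi_other ?cartan_cappk // subr0.
Qed.

Lemma cartan_inv_p x : x \in p -> theta x = - x.
Proof.
move=> xp; rewrite add_lfunE opp_lfunE [daddv_pi p k x]daddv_pi_id ?cartan_cappk //.
by rewrite daddv_pi_other ?cartan_capkp // sub0r.
Qed.

Lemma cartan_invK x : theta (theta x) = x.
Proof.
have [a [b [ak bp ->]]] := cartan_split x.
by rewrite !linearD /= !(cartan_inv_k ak, cartan_inv_p bp, linearN) /= cartan_inv_p // opprK.
Qed.

Lemma mem_cartan_k x : theta x = x -> x \in k.
Proof.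
have [a [b [ak bp ->]]] := cartan_split x.
rewrite linearD /= cartan_inv_k // cartan_inv_p // => /addrI/eqP.
by rewrite eq_sym -addr_eq0 -mulr2n -scaler_nat scaler_eq0 pnatr_eq0 => /eqP ->; rewrite addr0.
Qed.

Lemma cartan_lie_kk x y : x \in k -> y \in k -> lie x y \in k.
Proof. by move=> xk yk; case: cd => _ _ [/subvP h _ _] _ _; apply: h; apply: memv_lie_prod. Qed.
Lemma cartan_lie_kp x y : x \in k -> y \in p -> lie x y \in p.
Proof. by move=> xk yk; case: cd => _ _ [_ /subvP h _] _ _; apply: h; apply: memv_lie_prod. Qed.
Lemma cartan_lie_pp x y : x \in p -> y \in p -> lie x y \in k.
Proof. by move=> xk yk; case: cd => _ _ [_ _ /subvP h] _ _; apply: h; apply: memv_lie_prod. Qed.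

Lemma cartan_inv_lie x y : theta (lie x y) = lie (theta x) (theta y).
Proof.
have [a [b [ak bp ->]]] := cartan_split x; have [c [d [ck dp ->]]] := cartan_split y.
have adp := cartan_lie_kp ak dp; have acp := cartan_lie_kk ak ck.
have bdk := cartan_lie_pp bp dp.
have bcp : lie b c \in p by rewrite lieC memvN cartan_lie_kp.
rewrite !linearD /= !(cartan_inv_k ck, cartan_inv_p dp, cartan_inv_k ak, cartan_inv_p bp).
rewrite !lieDl !linearD /= (cartan_inv_k acp) (cartan_inv_p adp).
rewrite (cartan_inv_k bdk) (cartan_inv_p bcp).
by rewrite !lieNr !lieNl opprK.
Qed.

Lemma killing_cartan_inv x y : killing (theta x) (theta y) = killing x y.
Proof.
rewrite /killing.
transitivity (trace_on {:g} (theta \o (lie x \o lie y \o theta))).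
  apply: eq_trace_on => z _ /=.
  by rewrite -{1}[z]cartan_invK -!cartan_inv_lie.
rewrite trace_onC; try by move=> *; apply: memvf.
by apply: eq_trace_on => z _ /=; rewrite cartan_invK.
Qed.

Lemma cartan_form_sym x y : s x y = s y x.
Proof. by rewrite /s killingC -{1}killing_cartan_inv cartan_invK killingC killingC. Qed.

Lemma cartan_form_linear x : scalar (s x).
Proof. by move=> a y z; rewrite /s linearP /= linearP opprD mulrN. Qed.
HB.instance Definition _ x := GRing.isLinear.Build R g R *%R (s x) (cartan_form_linear x).

Lemma cartan_formDl x y z : s (x + y) z = s x z + s y z.
Proof. by rewrite /s killingDl opprD. Qed.

Lemma cartan_formZl c x z : s (c *: x) z = c * s x z.
Proof. by rewrite /s killingZl mulrN. Qed.

Lemma cartan_form0l x : s 0 x = 0.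
Proof. by rewrite /s killing0l oppr0. Qed.

Lemma cartan_formNl x z : s (- x) z = - s x z.
Proof. by rewrite /s killingNl. Qed.

(** The two summands are eigenspaces of an isometry of the Killing form, for
    distinct eigenvalues of square one. *)
Lemma killing_kp x y : x \in k -> y \in p -> killing x y = 0.
Proof.
move=> xk yp; have := killing_cartan_inv x y.
rewrite cartan_inv_k // cartan_inv_p // killingNr => /eqP.
by rewrite eq_sym -addr_eq0 -mulr2n mulrn_eq0 /= => /eqP.
Qed.

Lemma cartan_form_gt0 x : x != 0 -> 0 < s x x.
Proof.
have [a [b [ak bp ->]]] := cartan_split x => ab0.
rewrite /s linearD /= cartan_inv_k // cartan_inv_p // killingBr !killingDl.
rewrite [killing b a]killingC (killing_kp ak bp) addr0 add0r opprB.
case: cd => _ _ _ kneg ppos.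
have kle : killing a a <= 0 by have [->|/(kneg _ ak)/ltW//] := eqVneq a 0; rewrite killing0r.
have ple : 0 <= killing b b by have [->|/(ppos _ bp)/ltW//] := eqVneq b 0; rewrite killing0r.
have [a0|a0] := eqVneq a 0.
  have b0 : b != 0 by move: ab0; rewrite a0 add0r.
  by rewrite subr_gt0 (le_lt_trans kle) ?ppos.
by rewrite subr_gt0 (lt_le_trans _ ple) ?kneg.
Qed.

Lemma cartan_form_ge0 x : 0 <= s x x.
Proof.
have [->|/cartan_form_gt0/ltW//] := eqVneq x 0.
by rewrite linear0.
Qed.

Lemma cartan_form_eq0 x : s x x = 0 -> x = 0.
Proof. by move=> sx; apply/eqP/contraT => /cartan_form_gt0; rewrite sx ltxx. Qed.

Lemma cartan_form_lie u x y : s (lie u x) y = - s x (lie (theta u) y).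
Proof. by rewrite /s cartan_inv_lie cartan_invK killing_skew. Qed.

End CartanInvolution.

(** * Weights of the compact Cartan subalgebra *)

Section Weights.
Variables (R : realType) (g : lieAlgType R) (k p h0 : {vspace g}).
Hypothesis cd : cartan_decomposition k p.
Hypothesis h0k : (h0 <= k)%VS.
Hypothesis h0ab : lie_abelian h0.
Hypothesis h0cartan : cartan_subalgebra (cvspace h0).

Implicit Types (x y t : g) (U : {vspace g}) (a b : hdual h0) (z w : complexification g).
Local Notation theta := (cartan_inv k p).
Local Notation s := (cartan_form k p).

(** [i t] as an element of the space on which the roots are real. *)
Definition ipart t : subvs_of (ivspace h0) :=
  vsproj (ivspace h0) ((0, t) : complexification g).

Lemma val_ipart t : t \in h0 -> vsval (ipart t) = (0, t).
Proof. by move=> th; rewrite vsprojK // mem_ivspace eqxx th. Qed.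

Lemma mem_ipart (h : subvs_of (ivspace h0)) : (vsval h).2 \in h0.
Proof. by have := subvsP h; rewrite mem_ivspace => /andP[]. Qed.

Lemma ipartK (h : subvs_of (ivspace h0)) : ipart (vsval h).2 = h.
Proof.
apply: val_inj; rewrite /= (val_ipart (mem_ipart h)).
have := subvsP h; rewrite mem_ivspace => /andP[/eqP h1 _].
by case: (vsval h) h1 => u v /= ->.
Qed.

Definition wt a t : R := a (ipart t).

Lemma ipart_linear c t t' : ipart (c *: t + t') = c *: ipart t + ipart t'.
Proof. by rewrite -linearP; congr (vsproj _ _); congr pair; rewrite /= scaler0 addr0. Qed.

Lemma wt_linear a : scalar (wt a).
Proof. by move=> c t t'; rewrite /wt ipart_linear linearP. Qed.
HB.instance Definition _ a := GRing.isLinear.Build R g R *%R (wt a) (wt_linear a).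

Lemma wtD a b t : wt (a + b) t = wt a t + wt b t.
Proof. by rewrite /wt add_lfunE. Qed.
Lemma wtN a t : wt (- a) t = - wt a t.
Proof. by rewrite /wt opp_lfunE. Qed.
Lemma wtZ c a t : wt (c *: a) t = c * wt a t.
Proof. by rewrite /wt scale_lfunE. Qed.
Lemma wt0 t : wt 0 t = 0.
Proof. by rewrite /wt zero_lfunE. Qed.

Lemma wt_eq a b : (forall t, t \in h0 -> wt a t = wt b t) -> a = b.
Proof.
by move=> ab; apply/lfunP => h; rewrite -(ipartK h); apply: ab; apply: mem_ipart.
Qed.

Lemma wt_neq0 a : a != 0 -> exists2 t, t \in h0 & wt a t != 0.
Proof.
move=> a0; apply/not_exists2P => h; case/eqP: a0; apply: wt_eq => t th.
by rewrite wt0; apply/eqP/negPn/negP; case: (h t).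
Qed.

Lemma root_vectorP a z : root_vector a z <->
  forall t, t \in h0 -> lie t z.1 = wt a t *: z.2 /\ lie t z.2 = - (wt a t *: z.1).
Proof.
have lieE t : t \in h0 -> lie (vsval (ipart t)) z = (- lie t z.2, lie t z.1).
  move=> th; rewrite val_ipart // -[LHS]/(clie _ _) /clie /=.
  by rewrite !lie0l sub0r add0r.
split=> [za t th|za h].
  have := za (ipart t); rewrite lieE // -/(wt a t); case: (z) => x y [xy yx] /=.
  by rewrite yx -xy opprK.
have th := mem_ipart h; rewrite -(ipartK h) lieE //.
by have [-> ->] := za _ th; rewrite opprK -/(wt _ _); case: (z).
Qed.

(** An element commuting with [h0] normalizes the complexification of [h0]. *)
Lemma mem_cartan x : (forall t, t \in h0 -> lie t x = 0) -> x \in h0.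
Proof.
case: h0cartan => _ _ sn xh.
have : ((x, 0) : complexification g) \in cvspace h0.
  apply: sn => z; rewrite mem_cvspace => /andP[z1 z2].
  have -> : lie ((x, 0) : complexification g) z = 0.
    rewrite -[LHS]/(clie _ _) /clie /= !lie0l ![lie x _]lieC !xh //.
    by rewrite !oppr0 !addr0.
  exact: mem0v.
by rewrite mem_cvspace => /andP[].
Qed.

Lemma cartan_form_lie_h t x y : t \in h0 -> s (lie t x) y = - s x (lie t y).
Proof.
by move=> th; rewrite (cartan_form_lie cd) (cartan_inv_k cd) // (subvP h0k).
Qed.

Lemma cartan_form_lie0 t x : t \in h0 -> s (lie t x) x = 0.
Proof.
move=> th; have /eqP := cartan_form_lie_h x x th.
by rewrite [s x (lie t x)](cartan_form_sym cd) -addr_eq0 -mulr2n mulrn_eq0 => /eqP.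
Qed.

(** A joint eigenvector of [h0], which acts by commuting skew operators: its
    eigenvalues are imaginary, and they depend linearly on [t] because
    [[t, y] = - a x] expresses [a] as a quotient of inner products. *)
Lemma weight_pair U : U != 0%VS -> (forall t x, t \in h0 -> x \in U -> lie t x \in U) ->
  exists a z, [/\ root_vector a z, z.1 \in U, z.2 \in U & z.1 != 0].
Proof.
move=> U0 Uh.
have bh i : (vbasis h0)`_(nat_of_ord (i : 'I_(\dim h0))) \in h0.
  by rewrite vbasis_mem ?mem_nth ?size_tuple.
have [||x [y [xU yU x0 xy]]] :=
    joint_eigenpair (f := fun i : 'I_(\dim h0) => lie (vbasis h0)`_i) U0.
- by move=> i x xU; apply: Uh.
- by move=> i j x xU /=; rewrite lie_derivation (h0ab (bh i) (bh j)) lie0l add0r.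
pose F (h : subvs_of (ivspace h0)) : R^o := s (lie y (vsval h).2) x / s x x.
have Flin : linear F.
  move=> c h h'; rewrite /F /= linearP /= cartan_form_sym // linearP /=.
  by rewrite !(cartan_form_sym cd x) mulrDl -mulrA.
pose a : hdual h0 := linfun (HB.pack F (GRing.isLinear.Build _ _ _ _ F Flin) : {linear _ -> _}).
have aE t : t \in h0 -> wt a t = s (lie y t) x / s x x.
  by move=> th; rewrite /wt lfunE /= /F val_ipart.
have sx0 := lt0r_neq0 (cartan_form_gt0 cd x0).
exists a, (x, y); split=> //=; apply/root_vectorP => t /=.
rewrite -{1}(span_basis (vbasisP h0)); move: t.
apply: span_ind => [|c t t' [tx ty] [tx' ty']|t].
- by rewrite !lie0l linear0 !scale0r oppr0.
- rewrite !lieDl !lieZl linearP /= tx ty tx' ty' !scalerDl -!scalerA.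
  by rewrite scalerN opprD.
move=> /tnthP [i ->]; rewrite (tnth_nth 0).
have [r [c []]] := xy i; have := bh i.
move: ((vbasis h0)`_i) => {}t th tx ty.
have r0 : r = 0.
  have := cartan_form_lie0 x th; have := cartan_form_lie0 y th.
  rewrite tx ty !cartan_formDl cartan_formNl !cartan_formZl (cartan_form_sym cd y x).
  move=> ry rx; have /eqP : r * (s x x + s y y) = 0.
    by rewrite mulrDr; move: rx ry; set u := r * _; set v := r * _; lra.
  rewrite mulf_eq0 => /orP[/eqP//|].
  by rewrite gt_eqF // ltr_wpDr ?(cartan_form_gt0 cd) ?(cartan_form_ge0 cd).
move: tx ty; rewrite r0 !scale0r !add0r => tx ty.
have -> : wt a t = - c.
  by rewrite aE // lieC ty cartan_formNl cartan_formZl mulNr mulfK.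
by rewrite tx ty !scaleNr opprK.
Qed.

(** What is left of an [h0]-stable subspace once the weight plane of one joint
    eigenvector is removed is its orthogonal complement for [cartan_form],
    which is stable too because [h0] acts by skew operators. *)
Lemma weight_span U : (forall t x, t \in h0 -> x \in U -> lie t x \in U) ->
  exists2 xs : seq g, U = <<xs>>%VS & forall x, x \in xs ->
    x \in h0 \/ exists a z, [/\ is_root a, root_vector a z, z.1 = x & z.2 \in U].
Proof.
have [n] := ubnP (\dim U); elim: n U => // n IHn U dimU Uh.
have [->|U0] := eqVneq U 0%VS; first by exists [::]; rewrite ?span_nil.
have [a [[x y] /= [az xU yU x0]]] := weight_pair U0 Uh.
have := root_vectorP a (x, y); rewrite /= => -[/(_ az) xy _].
pose G u := u \in h0 \/ exists a z, [/\ is_root a, root_vector a z, z.1 = u & z.2 \in U].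
have {az xy y yU} [y [yU sxy xy Gx Gy]] : exists y, [/\ y \in U, s x y = 0,
    forall t, t \in h0 -> exists c, lie t x = c *: y /\ lie t y = - (c *: x), G x & G y].
  (* A weight zero vector is dealt with one real element at a time. *)
  have [a0|a0] := eqVneq a 0.
    have xh t : t \in h0 -> lie t x = 0 by move=> /xy[-> _]; rewrite a0 wt0 scale0r.
    exists 0; split; rewrite ?mem0v ?linear0 //; try by left; rewrite ?mem0v ?mem_cartan.
    by move=> t /xh th; exists 0; split; rewrite ?th ?linear0 ?scale0r ?oppr0.
  have root_a : is_root a.
    split=> //; exists (x, y) => //; apply: contraNneq x0.
    by move=> /(congr1 (fun z : complexification g => z.1)) /= ->.
  exists y; split=> //; last 2 first.
  - by right; exists a, (x, y).
  - right; exists a, (y, - x); split; rewrite /= ?memvN //.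
    apply/root_vectorP => t /xy[tx ty] /=.
    by rewrite lieNr tx ty scalerN.
  - have [t th at0] := wt_neq0 a0; have := cartan_form_lie0 x th.
    have [-> _] := xy _ th; rewrite cartan_formZl (cartan_form_sym cd).
    by move/eqP; rewrite mulf_eq0 (negPf at0) => /eqP.
  - by move=> t /xy; exists (wt a t).
pose orth u : 'Hom(g, R^o) := linfun (s u : g -> R^o).
have orthE u v : (v \in lker (orth u)) = (s u v == 0) by rewrite memv_ker lfunE.
pose U' := (U :&: (lker (orth x) :&: lker (orth y)))%VS.
have memU' v : (v \in U') = [&& v \in U, s x v == 0 & s y v == 0].
  by rewrite !memv_cap !orthE.
have [||xs U'xs Gxs] := IHn U'.
- rewrite -ltnS (leq_trans _ dimU) // ltnS ltn_neqAle dimvS ?capvSl // andbT.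
  apply/negP => /eqP dimU'; have /eqP U'U : U' == U by rewrite eqEdim capvSl dimU' /=.
  by move: xU; rewrite -U'U memU' gt_eqF ?andbF // (cartan_form_gt0 cd).
- move=> t u th; rewrite !memU' => /and3P[uU /eqP xu /eqP yu].
  have [c [tx ty]] := xy _ th.
  have skew v : s v (lie t u) = - s (lie t v) u by rewrite cartan_form_lie_h // opprK.
  by rewrite Uh // !skew tx ty cartan_formNl !cartan_formZl xu yu !mulr0 !oppr0 eqxx.
exists [:: x, y & xs].
  apply/eqP; rewrite eqEsubv; apply/andP; split; last first.
    apply/span_subvP => u; rewrite !inE => /or3P[/eqP->|/eqP->|uxs] //.
    by have := memv_span uxs; rewrite -U'xs memU' => /andP[].
  apply/subvP => u uU; rewrite !span_cons -U'xs.
  have sx0 := lt0r_neq0 (cartan_form_gt0 cd x0).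
  pose u' := u - (s x u / s x x) *: x - (s y u / s y y) *: y.
  have -> : u = (s x u / s x x) *: x + ((s y u / s y y) *: y + u').
    by rewrite /u' -[u - _ - _]addrA -opprD addrA addrC subrK.
  rewrite !memv_add ?memvZ ?memv_line // memU' !rpredB ?memvZ //=.
  rewrite !linearB !linearZ /= (cartan_form_sym cd y x) sxy !mulr0 !subr0 mulfVK // subrr eqxx.
  have [->|y0] := eqVneq y 0; first by rewrite !cartan_form0l mulr0 subr0 eqxx.
  by rewrite mulfVK ?subrr ?eqxx // lt0r_neq0 ?(cartan_form_gt0 cd).
move=> u; rewrite !inE => /or3P[/eqP->|/eqP->|/Gxs] //.
case=> [|[b [z [rb bz zu zU']]]]; [by left | right; exists b, z; split=> //].
by move: zU'; rewrite memU' => /andP[].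
Qed.
End Weights.

(** * Duality and the Cartan matrix *)

Section DualVectors.
Variables (R : realType) (g : lieAlgType R) (k p h0 : {vspace g}).
Hypothesis cd : cartan_decomposition k p.
Hypothesis h0k : (h0 <= k)%VS.
Implicit Types (x y t : g) (a b psi : hdual h0) (h : subvs_of (ivspace h0)).

Lemma ckilling_ivspace h h' :
  ckilling (vsval h) (vsval h') = - killing (vsval h).2 (vsval h').2.
Proof.
rewrite /ckilling; have := subvsP h; rewrite mem_ivspace => /andP[/eqP -> _].
by rewrite killing0l sub0r.
Qed.

Lemma killing_h0_lt0 t : t \in h0 -> t != 0 -> killing t t < 0.
Proof. by move=> th; case: cd => _ _ _ + _; apply; apply: (subvP h0k). Qed.

Lemma killing_h0_eq0 t : t \in h0 -> (forall t', t' \in h0 -> killing t t' = 0) -> t = 0.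
Proof.
move=> th tt; apply/eqP/contraT => /(killing_h0_lt0 th).
by rewrite tt ?ltxx.
Qed.

(** [h_psi] divided by [i], an element of the real form. *)
Definition hvec psi : g := (vsval (dual_vector psi)).2.

Lemma hvec_h0 psi : hvec psi \in h0. Proof. exact: mem_ipart. Qed.

Lemma vsval2P c h h' : (vsval (c *: h + h')).2 = c *: (vsval h).2 + (vsval h').2.
Proof. by []. Qed.

Lemma killing_functional_linear t :
  linear (fun h => - killing t (vsval h).2 : R^o).
Proof. by move=> c u w; rewrite vsval2P killingDr killingZr opprD -mulrN. Qed.

Definition killing_functional t : hdual h0 :=
  linfun (HB.pack (fun h => - killing t (vsval h).2 : R^o)
    (GRing.isLinear.Build _ _ _ _ _ (killing_functional_linear t))
    : {linear _ -> _}).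

Lemma killing_functionalE t h :
  (killing_functional t h : R) = - killing t (vsval h).2.
Proof. by rewrite lfunE. Qed.

(** The map [h |-> ckilling h] from [i h0] to its dual is injective because
    [killing] is definite on [h0], hence onto for dimension reasons. *)
Lemma dual_vector_exists psi :
  exists h, forall h', (psi h' : R) = ckilling (vsval h) (vsval h').
Proof.
pose G h := killing_functional (vsval h).2.
have Glin : linear G.
  move=> c u w; apply/lfunP => h'.
  rewrite add_lfunE scale_lfunE /G !killing_functionalE vsval2P.
  by rewrite killingDl killingZl opprD -mulrN.
pose Phi : 'Hom(subvs_of (ivspace h0), hdual h0) :=
  linfun (HB.pack G (GRing.isLinear.Build _ _ _ _ G Glin) : {linear _ -> _}).
have PhiE h : Phi h = G h by rewrite lfunE.
have Phi0 : lker Phi == 0%VS.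
  apply/eqP/vspaceP => h; rewrite memv_ker memv0.
  apply/eqP/eqP => [|->]; last by rewrite linear0.
  rewrite PhiE => Gh; have h2 : (vsval h).2 = 0.
    apply: killing_h0_eq0; first exact: mem_ipart.
    move=> t th; have := congr1 (fun f : hdual h0 => f (ipart h0 t)) Gh.
    rewrite killing_functionalE zero_lfunE val_ipart //= => /eqP.
    by rewrite oppr_eq0 => /eqP.
  by rewrite -(ipartK h) h2 /ipart linear0.
have : psi \in limg Phi.
  suff -> : limg Phi = fullv by apply: memvf.
  apply/eqP; rewrite eqEdim subvf /= limg_dim_eq ?(eqP Phi0) ?capv0 //.
  by rewrite !dimvf /= /dim /= muln1.
case/memv_imgP => h _ ->; exists h => h'.
by rewrite PhiE killing_functionalE ckilling_ivspace.
Qed.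

Lemma wt_hvec psi t : t \in h0 -> wt psi t = - killing (hvec psi) t.
Proof.
move=> th; have := @classical_sets.xgetPex _ 0
  (fun h => forall h', (psi h' : R) = ckilling (vsval h) (vsval h'))
  (dual_vector_exists psi).
rewrite -/(dual_vector psi) => /= /(_ (ipart h0 t)).
by rewrite ckilling_ivspace val_ipart.
Qed.

Lemma hvec_eq psi t : t \in h0 ->
  (forall t', t' \in h0 -> wt psi t' = - killing t t') -> hvec psi = t.
Proof.
move=> th tE; apply/eqP; rewrite -subr_eq0; apply/eqP/killing_h0_eq0.
  by rewrite memvB ?hvec_h0.
move=> t' t'h; rewrite killingDl killingNl.
by rewrite -[killing t t']opprK -tE // wt_hvec // opprK addrN.
Qed.

Lemma hvec_functional t : t \in h0 -> hvec (killing_functional t) = t.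
Proof.
move=> th; apply: hvec_eq => // t' t'h.
by rewrite /wt killing_functionalE val_ipart.
Qed.

Lemma hvec_linear : linear hvec.
Proof.
move=> c a b; apply: hvec_eq => [|t th]; first by rewrite memvD ?memvZ ?hvec_h0.
by rewrite wtD wtZ killingDl killingZl !wt_hvec // mulrN -opprD.
Qed.
HB.instance Definition _ := GRing.isLinear.Build R (hdual h0) g *:%R hvec hvec_linear.

Lemma hvec_sum l (u : 'I_l -> R) (f : 'I_l -> hdual h0) :
  hvec (\sum_i u i *: f i) = \sum_i u i *: hvec (f i).
Proof. by rewrite linear_sum; apply: eq_bigr => i _; rewrite linearZ. Qed.

Lemma ipE a b : ip a b = - killing (hvec a) (hvec b).
Proof. exact: ckilling_ivspace. Qed.

Lemma ip_wt a b : ip a b = wt a (hvec b).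
Proof. by rewrite ipE wt_hvec ?hvec_h0. Qed.

Lemma ipC a b : ip a b = ip b a.
Proof. by rewrite !ipE killingC. Qed.

Lemma ipNr a b : ip a (- b) = - ip a b.
Proof. by rewrite ipC [in RHS]ipC !ip_wt wtN. Qed.

Lemma ip_gt0 a : a != 0 -> 0 < ip a a.
Proof.
move=> a0; rewrite ipE oppr_gt0 killing_h0_lt0 ?hvec_h0 //.
apply: contraNneq a0 => a0; apply/eqP/wt_eq => t th.
by rewrite wt_hvec // a0 killing0l oppr0 wt0.
Qed.

Lemma ip_eq0 a : (ip a a == 0) = (a == 0).
Proof.
have [->|/ip_gt0/gt_eqF//] := eqVneq a 0.
by rewrite ip_wt wt0 eqxx.
Qed.

Lemma ip_sumr a l (u : 'I_l -> R) (f : 'I_l -> hdual h0) :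
  ip a (\sum_i u i *: f i) = \sum_i u i * ip a (f i).
Proof.
rewrite ip_wt hvec_sum linear_sum; apply: eq_bigr => i _.
by rewrite ip_wt linearZ.
Qed.

Lemma ip_suml a l (u : 'I_l -> R) (f : 'I_l -> hdual h0) :
  ip (\sum_i u i *: f i) a = \sum_i u i * ip (f i) a.
Proof. by rewrite ipC ip_sumr; apply: eq_bigr => i _; rewrite ipC. Qed.

Lemma ip_nat_comb l (gam : l.-tuple (hdual h0)) (n : 'I_l -> nat) a :
  ip a (nat_comb gam n) = \sum_i (n i)%:R * ip a (tnth gam i).
Proof.
rewrite -ip_sumr; congr (ip _ _); apply: eq_bigr => i _.
by rewrite scaler_nat.
Qed.

(** The simple roots being independent and [ip] definite, the Cartan matrix is
    a Gram matrix up to scaling its rows, hence invertible. *)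
Lemma cartan_matrix_unit l (gam : l.-tuple (hdual h0)) : free gam ->
  cartan_matrix gam \in unitmx.
Proof.
move=> gfree; have /freeP gfree' := gfree.
have gam0 i : ip (tnth gam i) (tnth gam i) != 0.
  by rewrite ip_eq0 (free_not0 gfree) ?mem_tnth.
rewrite -unitmx_tr -row_free_unit; apply: inj_row_free => u uA.
have uE i : u 0 i = 0; last by apply/rowP => i; rewrite uE mxE.
move: i; apply: gfree'; apply/eqP; rewrite -ip_eq0 ip_suml; apply/eqP/big1 => i _.
rewrite ip_sumr; have /rowP/(_ i) := uA; rewrite !mxE => uAi.
suff -> : \sum_i0 u 0 i0 * ip gam`_i gam`_i0 = 0 by rewrite mulr0.
have gi j : gam`_(nat_of_ord (j : 'I_l)) = tnth gam j by rewrite (tnth_nth 0).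
apply: (mulfI (x := 2 / ip (tnth gam i) (tnth gam i))).
  by rewrite mulf_neq0 ?invr_neq0 ?pnatr_eq0.
rewrite mulr0 -[RHS]uAi mulr_sumr; apply: eq_bigr => j _.
by rewrite !mxE !gi; ring.
Qed.

(** The column [q] of the inverse Cartan matrix is chosen for this: pairing with
    [gamma_i] is, up to the factor [(gamma_i, gamma_i) / 2], applying the row
    [i] of the Cartan matrix. *)
Lemma ip_fundamental_weight l (gam : l.-tuple (hdual h0)) q i : free gam ->
  ip (fundamental_weight gam q) (tnth gam i) =
    (i == q)%:R * (ip (tnth gam q) (tnth gam q) / 2).
Proof.
move=> gfree; have gam0 : ip (tnth gam i) (tnth gam i) != 0.
  by rewrite ip_eq0 (free_not0 gfree) ?mem_tnth.
have /matrixP/(_ i q) := mulmxV (cartan_matrix_unit gfree).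

have -> : ip (fundamental_weight gam q) (tnth gam i) =
   (cartan_matrix gam *m invmx (cartan_matrix gam)) i q * (ip (tnth gam i) (tnth gam i) / 2).
  rewrite ip_suml mxE mulr_suml; apply: eq_bigr => j _.
  by rewrite [cartan_matrix _ _ _]mxE ipC; field.
by move=> ->; rewrite mxE; case: eqP => [->|_] /=; rewrite ?mul1r ?mul0r.
Qed.
End DualVectors.

(** * Parity of roots *)

Section Parity.
Variables (R : realType) (g : lieAlgType R) (k p h0 : {vspace g}).
Hypothesis cd : cartan_decomposition k p.
Hypothesis h0k : (h0 <= k)%VS.
Hypothesis h0cartan : cartan_subalgebra (cvspace h0).

Implicit Types (x y t : g) (U : {vspace g}) (a b : hdual h0) (z w : complexification g).
Local Notation theta := (cartan_inv k p).
Local Notation s := (cartan_form k p).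

(** Conjugation with respect to the real form. *)
Definition cconj z : complexification g := (z.1, - z.2).

Lemma root_vector_conj a z : root_vector a z -> root_vector (- a) (cconj z).
Proof.
move/root_vectorP => za; apply/root_vectorP => t /za[zx zy] /=.
by rewrite wtN zx lieNr zy !scaleNr !scalerN !opprK.
Qed.

Lemma root_vector_lie a b z w :
  root_vector a z -> root_vector b w -> root_vector (a + b) (lie z w).
Proof.
move=> za wb h; rewrite lie_derivation za wb lieZl linearZ /= -scalerDl.
by rewrite add_lfunE.
Qed.

Lemma root_vector_lin c a z w :
  root_vector a z -> root_vector a w -> root_vector a (c *: z + w).
Proof.
by move=> za wa h; rewrite linearP /= za wa scalerDr !scalerA mulrC.
Qed.

Lemma root_vector_theta a z :
  root_vector a z -> root_vector a ((theta z.1, theta z.2) : complexification g).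
Proof.
move/root_vectorP => za; apply/root_vectorP => t th /=; have [zx zy] := za _ th.
have tt : t = theta t by rewrite (cartan_inv_k cd) // (subvP h0k).
by rewrite {1 3}tt -!(cartan_inv_lie cd) zx zy linearN !linearZ.
Qed.

(** An eigenvector of the complex linear extension of the Cartan involution. *)
Definition theta_eigen c z := theta z.1 = c *: z.1 /\ theta z.2 = c *: z.2.

Lemma theta_eigen_conj c z : theta_eigen c z -> theta_eigen c (cconj z).
Proof. by case=> z1 z2; split=> //=; rewrite linearN /= z2 scalerN. Qed.

Lemma theta_eigen_lie c d z w :
  theta_eigen c z -> theta_eigen d w -> theta_eigen (c * d) (lie z w).
Proof.
move=> [z1 z2] [w1 w2]; rewrite -[lie z w]/(clie z w).
split; rewrite /= !(linearB, linearD) /= !(cartan_inv_lie cd) z1 z2 w1 w2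
  !lieZl !linearZ /= ?scalerBr ?scalerDr !scalerA ?[d * c]mulrC //.
Qed.

Lemma theta_eigenN c z : c != 0 -> theta_eigen c z -> theta_eigen (- c) z -> z = 0.
Proof.
move=> c0 [z1 z2] []; rewrite z1 z2.
have eq0 (u : g) : c *: u = - c *: u -> u = 0.
  move/eqP; rewrite scaleNr -addr_eq0 -mulr2n -scaler_nat !scaler_eq0 pnatr_eq0.
  by rewrite (negPf c0) => /eqP.
by move=> /eq0 zz1 /eq0 zz2; rewrite [z]surjective_pairing zz1 zz2.
Qed.

Lemma root_vector2_neq0 a z : a != 0 -> root_vector a z -> z != 0 -> z.2 != 0.
Proof.
move=> a0 /root_vectorP za; have [t th at0] := wt_neq0 a0; have [_ zy] := za _ th.
apply: contraNneq => z2; move: zy; rewrite z2 linear0 => /esym/eqP.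
rewrite oppr_eq0 scaler_eq0 (negPf at0) /= => /eqP z1.
by case: (z) z1 z2 => u v /= -> ->.
Qed.

(** In complex terms, the bracket of [cconj z] and [z] is [2 i [z.1, z.2]]; it is
    proportional to [h_a], as the bracket of opposite root vectors always is. *)
Lemma lie_root_conj a z : root_vector a z ->
  lie z.1 z.2 = - killing z.2 z.2 *: hvec a.
Proof.
move/root_vectorP => za.
have th : lie z.1 z.2 \in h0.
  apply: (mem_cartan h0cartan) => t /za[zx zy].
  by rewrite lie_derivation zx zy lieNr linearZ /= lieZl !liexx !scaler0 oppr0 addr0.
apply/eqP; rewrite -subr_eq0; apply/eqP; apply: (killing_h0_eq0 cd h0k) => [|t t0].
  by rewrite memvB ?memvZ ?hvec_h0.
rewrite killingDl killingNl killingZl killingC -killing_lie.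
have [-> _] := za _ t0.
by rewrite (wt_hvec cd h0k) // killingZl; ring.
Qed.

(** This is the computation of the norm of [[e, z]] for the Hermitian extension
    of [cartan_form] to the complexification, carried out in real and imaginary
    parts: the adjoint of [ad e] is [- c *: ad (cconj e)], so if [cconj e]
    kills [z] then that squared norm is a negative multiple of [ip a b]. *)
Lemma ip_lowest_le0 a b e z (c : R) :
    root_vector b e -> theta e.1 = c *: e.1 -> theta e.2 = c *: e.2 -> e.2 != 0 ->
    root_vector a z -> z != 0 -> lie (cconj e) z = 0 ->
  ip a b <= 0.
Proof.
move=> eb th1 th2 e20 /root_vectorP za z0.
have tE := lie_root_conj eb; have {}th : lie e.1 e.2 \in h0 by rewrite tE memvZ ?hvec_h0.
have [tx ty] := za _ th.
case: e {eb} th1 th2 e20 tE th tx ty => e1 e2 /= th1 th2 e20 tE th tx ty.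
case: z {za} z0 tx ty => x y z0 /= tx ty ez.
have e1x : lie e1 x = - lie e2 y.
  have := congr1 (fun w : complexification g => w.1) ez.
  by rewrite -[lie _ _]/(clie _ _) /clie /= lieNl opprK => /eqP; rewrite addr_eq0 => /eqP.
have e1y : lie e1 y = lie e2 x.
  have := congr1 (fun w : complexification g => w.2) ez.
  by rewrite -[lie _ _]/(clie _ _) /clie /= lieNl => /eqP; rewrite subr_eq0 => /eqP.
have s1 u v : s (lie e1 u) v = - (c * s u (lie e1 v)).
  by rewrite (cartan_form_lie cd) th1 lieZl linearZ.
have s2 u v : s (lie e2 u) v = - (c * s u (lie e2 v)).
  by rewrite (cartan_form_lie cd) th2 lieZl linearZ.
(* Each squared norm is computed twice, moving [e1] or [e2] across; the sum of
   the four expressions assembles the bracket [[e1, e2]]. *)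
have P1 : s (lie e1 x) (lie e1 x) = c * s x (lie e1 (lie e2 y)).
  by rewrite {2}e1x linearN /= s1 opprK.
have P2 : s (lie e1 x) (lie e1 x) = c * s y (lie e2 (lie e1 x)).
  by rewrite {1}e1x cartan_formNl s2 opprK.
have Q1 : s (lie e1 y) (lie e1 y) = - (c * s y (lie e1 (lie e2 x))).
  by rewrite {2}e1y s1.
have Q2 : s (lie e1 y) (lie e1 y) = - (c * s x (lie e2 (lie e1 y))).
  by rewrite {1}e1y s2.
have PQ : (s (lie e1 x) (lie e1 x) + s (lie e1 y) (lie e1 y)) * 2 =
    - (c * wt a (lie e1 e2) * (s x x + s y y)).
  rewrite mulrDl !mulr_natr !mulr2n {1}P1 P2 {1}Q1 Q2.
  have := congr1 (s x) ty; have := congr1 (s y) tx.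
  rewrite lie_lieE linearB linearZ /= lie_lieE linearB linearN linearZ /=.
  set u1 := s y (lie e1 _); set u2 := s y _; set u3 := s x (lie e1 _); set u4 := s x (lie e2 _).
  move=> h1 h2; have -> : u1 = u2 + wt a (lie e1 e2) * s y y by rewrite -h1; ring.
  have -> : u3 = u4 - wt a (lie e1 e2) * s x x by rewrite -h2; ring.
  ring.
have zpos : 0 < s x x + s y y.
  have [x0|x0] := eqVneq x 0; last by rewrite ltr_wpDr ?(cartan_form_gt0 cd) ?(cartan_form_ge0 cd).
  have [y0|y0] := eqVneq y 0; last by rewrite ltr_wpDl ?(cartan_form_gt0 cd) ?(cartan_form_ge0 cd).
  by move: z0; rewrite x0 y0 eqxx.
have : 0 <= - (c * wt a (lie e1 e2) * (s x x + s y y)).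
  by rewrite -PQ mulr_ge0 // addr_ge0 ?(cartan_form_ge0 cd).
rewrite oppr_ge0 pmulr_lle0 // tE linearZ /= -(ip_wt cd h0k).
have -> : c * (- killing e2 e2 * ip a b) = s e2 e2 * ip a b.
  by rewrite /s th2 killingZr; ring.
by rewrite pmulr_rle0 // (cartan_form_gt0 cd).
Qed.

Variables (l : nat) (gam : l.-tuple (hdual h0)) (q : 'I_l).
Hypothesis gam_simple : simple_roots gam.
Hypothesis gam_vogan : vogan_painting k p gam [set q].

Lemma simple_free : free gam. Proof. by case: gam_simple => /basis_free. Qed.

Lemma coord_nat_comb n i : coord gam i (nat_comb gam n) = (n i)%:R.
Proof.
rewrite -(coord_sum_free (fun i => (n i)%:R) i simple_free); congr (coord _ _ _).
by apply: eq_bigr => j _; rewrite scaler_nat (tnth_nth 0).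
Qed.

Lemma coord_simple i j : coord gam i (tnth gam j) = (i == j)%:R.
Proof. by rewrite (tnth_nth 0) coord_free ?simple_free // eq_sym. Qed.

Lemma theta_simple i z : root_vector (tnth gam i) z ->
  theta_eigen ((-1) ^+ (i == q)) z.
Proof.
move=> zi; have := gam_vogan i; rewrite in_set1; case: eqP => _ [_ /(_ z zi)];
  rewrite mem_cvspace => /andP[z1 z2]; rewrite /theta_eigen.
  by rewrite expr1 !scaleN1r !(cartan_inv_p cd).
by rewrite expr0 !scale1r !(cartan_inv_k cd).
Qed.

(** Bracketing with the conjugate of a simple root vector lowers the height and
    changes the parity of the degree and the eigenvalue of the Cartan involution
    alike, so at minimal height the bracket vanishes for every simple root. *)
Lemma no_bad_root_vector n z : nat_comb gam n != 0 -> root_vector (nat_comb gam n) z ->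
  theta_eigen (- (-1) ^+ n q) z -> z = 0.
Proof.
have [m] := ubnP (\sum_i n i)%N; elim: m n z => // m IHm n z nm n0 zn zeps.
apply/eqP/contraT => z0; have [gam_basis gam_root roots] := gam_simple.
suff ip_le0 i : ip (nat_comb gam n) (tnth gam i) <= 0.
  have := ip_gt0 cd h0k n0; rewrite ltNge (ip_nat_comb cd h0k) sumr_le0 // => i _.
  by rewrite mulr_ge0_le0.
have [gi0 [e ei e0]] := gam_root i.
have eeps := theta_simple ei; have [e1 e2] := eeps.
apply: (ip_lowest_le0 ei e1 e2 (root_vector2_neq0 gi0 ei e0) zn z0).
apply/eqP/contraT => w0.
have wroot := root_vector_lie (root_vector_conj ei) zn.
have [ai|ai] := eqVneq (nat_comb gam n) (tnth gam i).
  have ni j : n j = (j == i).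
    have /eqP := congr1 (coord gam j) ai.
    by rewrite coord_nat_comb coord_simple eqr_nat => /eqP.
  move/eqP: z0; case; apply: (theta_eigenN (c := (-1) ^+ n q)) => //.
    by rewrite expf_eq0 oppr_eq0 oner_eq0 andbF.
  by move: zn; rewrite ni eq_sym ai => /theta_simple.
have bi0 : - tnth gam i + nat_comb gam n != 0 by rewrite addrC subr_eq0.
have [n' [n'E|n'E]] := roots _ (conj bi0 (ex_intro2 _ _ _ wroot w0)).
  have nE j : n j = ((j == i) + n' j)%N.
    have := congr1 (coord gam j) n'E; rewrite linearD linearN /= !coord_nat_comb coord_simple.
    move/eqP; rewrite addrC subr_eq -natrD eqr_nat addnC => /eqP -> //.
  move/eqP: w0; case; apply: (IHm n').
  - move: nm; rewrite (eq_bigr _ (fun j _ => nE j)) big_split /=.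
    by rewrite (bigD1 i) //= eqxx big1 => [|j /negPf->].
  - by rewrite -n'E.
  - by rewrite -n'E.
  have := theta_eigen_lie (theta_eigen_conj eeps) zeps.
  rewrite nE eq_sym exprD; congr (theta_eigen _ _).
  by case: eqP => _; rewrite ?expr0 ?expr1; ring.
(* The difference is minus a positive combination: then [n] is zero or the
   indicator of [i], both excluded. *)
have nn' j : ((n j + n' j)%N = (j == i)).
  have := congr1 (coord gam j) n'E; rewrite linearD !linearN /= !coord_nat_comb coord_simple.
  by move=> h; apply/eqP; rewrite -(eqr_nat R) natrD; apply/eqP; lra.
case: (posnP (n i)) => ni.
  case/eqP: n0; rewrite /nat_comb big1 // => j _; have := nn' j.
  by case: eqP => [->|_]; rewrite ?ni ?mulr0n //; case: (n j).
case/eqP: ai; rewrite /nat_comb (bigD1 i) //= big1 ?addr0 => [|j /negPf ji].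
  by have := nn' i; rewrite eqxx; case: (n i) ni => [|[|]].
by have := nn' j; rewrite ji; case: (n j).
Qed.

(** The grading of [g + i g] by the coordinate along the painted simple root
    induces the Cartan involution: the component of [z] in the wrong eigenspace
    is a root vector that cannot exist. *)
Lemma theta_root n z : nat_comb gam n != 0 -> root_vector (nat_comb gam n) z ->
  theta_eigen ((-1) ^+ n q) z.
Proof.
move=> n0 zn; pose w : complexification g := (theta z.1, theta z.2).
have : - (-1) ^+ n q *: w + z = 0.
  apply: (no_bad_root_vector n0).
    by apply: root_vector_lin => //; apply: root_vector_theta.
  by split; rewrite /= linearD linearZ /= (cartan_invK cd) scalerDr scalerA mulrNN
    -expr2 sqrr_sign scale1r addrC scaleNr.
move=> wz; have zw : z = (-1) ^+ n q *: w.
  by apply/eqP; rewrite -subr_eq0 -scaleNr addrC wz.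
by split; rewrite {2}zw /= scalerA -expr2 sqrr_sign scale1r.
Qed.
End Parity.

(** * The Chern connection and its Ricci form *)

Section ChernConnection.
Variables (R : realType) (g : lieAlgType R) (h0 : {vspace g}) (phi : hdual h0).
Implicit Types (x y z u h : g) (J T D : 'End(g)).

Local Notation v := (orbit_pt phi).
Local Notation m := (mspace phi).
Local Notation st := (stab phi).
Local Notation prm := (pr_m phi).
Local Notation prs := (pr_stab phi).

Lemma mem_stab x : (x \in st) = (lie v x == 0).
Proof. by rewrite memv_ker adE. Qed.

Lemma stabE x : x \in st -> lie v x = 0.
Proof. by rewrite mem_stab => /eqP. Qed.

Lemma stab_v : v \in st.
Proof. by rewrite mem_stab liexx. Qed.

Lemma stab_lie x y : x \in st -> y \in st -> lie x y \in st.
Proof.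
by move=> xs ys; rewrite mem_stab lie_derivation (stabE xs) (stabE ys) lie0l linear0 addr0.
Qed.

Lemma mem_mspace x : (forall u, u \in st -> killing u x = 0) -> x \in m.
Proof. by move=> h; apply/killing_orthP. Qed.

Lemma mspaceE x u : x \in m -> u \in st -> killing u x = 0.
Proof. by move=> /killing_orthP; apply. Qed.

Lemma mspace_lie h x : h \in st -> x \in m -> lie h x \in m.
Proof.
move=> hs xm; apply: mem_mspace => u us.
by rewrite -killing_lie (mspaceE xm) ?stab_lie.
Qed.

Lemma mspace_lie_v x : lie v x \in m.
Proof.
apply: mem_mspace => u us; rewrite -killing_lie lieC (stabE us) oppr0.
exact: killing0l.
Qed.

Hypothesis m_st : (m :&: st = 0)%VS.

(** The image of [ad v] is orthogonal to its kernel, the stabilizer; counting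
    dimensions, it fills the orthogonal complement. *)
Lemma limg_ad_v : limg (ad v) = m /\ (m + st = {:g})%VS.
Proof.
have Lm : (limg (ad v) <= m)%VS.
  by apply/subvP => _ /memv_imgP [x _ ->]; rewrite adE mspace_lie_v.
have dimL := limg_ker_dim (ad v) {:g}; rewrite capfv in dimL.
have dimm := dimv_disjoint_sum m_st.
have leg := dimvS (subvf (m + st)); rewrite -dimL dimm addnC leq_add2l in leg.
have Lm' : limg (ad v) = m by apply/eqP; rewrite eqEdim Lm.
by split=> //; apply/eqP; rewrite eqEdim subvf dimm -dimL Lm' addnC leqnn.
Qed.

Lemma mspace_imgP x : x \in m -> exists2 y, y \in m & x = lie v y.
Proof.
have [Lm mst] := limg_ad_v; rewrite -{1}Lm => /memv_imgP [y _ ->].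
have /memv_addP [a am [b bs ->]] : y \in (m + st)%VS by rewrite mst memvf.
by exists a => //; rewrite adE lieDr (stabE bs) addr0.
Qed.

Lemma pr_mem x : prm x \in m /\ prs x \in st. Proof. by rewrite !memv_pi. Qed.

Lemma pr_add x : x = prm x + prs x.
Proof. by rewrite [RHS](daddv_pi_add m_st) // limg_ad_v.2 memvf. Qed.

Lemma pr_m_id x : x \in m -> prm x = x. Proof. exact: daddv_pi_id. Qed.

Lemma pr_m_stab x : x \in st -> prm x = 0. Proof. exact: daddv_pi_other. Qed.

Lemma pr_m_lie h x : h \in st -> prm (lie h x) = lie h (prm x).
Proof.
move=> hs; have [xm xs] := pr_mem x.
rewrite {1}[x]pr_add lieDr linearD /= [prm (lie h (prs x))]pr_m_stab ?stab_lie // addr0.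
by rewrite pr_m_id ?mspace_lie.
Qed.

Lemma lie_v_pr_m x : lie v (prm x) = lie v x.
Proof. by rewrite {2}[x]pr_add lieDr (stabE (pr_mem x).2) addr0. Qed.

Lemma omegaE x y : omega phi x y = killing (lie v x) y.
Proof. by rewrite /omega killing_lie. Qed.

Lemma omegaC x y : omega phi x y = - omega phi y x.
Proof. by rewrite /omega lieC linearN. Qed.

(** The operators that matter are odd polynomials in [ad v]; what is used of
    them is that they commute with the stabilizer, vanish on it and are skew
    for the Killing form. *)
Definition stab_skew T :=
  [/\ forall h x, h \in st -> T (lie h x) = lie h (T x),
      forall x y, killing (T x) y = - killing x (T y)
    & forall x, x \in st -> T x = 0].

Section StabSkew.
Variable T : 'End(g).
Hypothesis Tok : stab_skew T.

Lemma stab_skew_mem x : T x \in m.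
Proof.
have [_ Ts T0] := Tok; apply: mem_mspace => u us.
by apply/eqP; rewrite -oppr_eq0 -Ts T0 ?killing0l.
Qed.

Lemma stab_skew_pr x : T (prm x) = T x.
Proof.
have [_ _ T0] := Tok; have [_ xs] := pr_mem x.
by rewrite {2}[x]pr_add linearD /= (T0 _ xs) addr0.
Qed.

Lemma stab_skew_omega x y : omega phi (T x) y = - omega phi x (T y).
Proof.
have [Tc Ts _] := Tok.
by rewrite !omegaE -Tc ?stab_v // Ts.
Qed.

End StabSkew.

Variables J K : 'End(g).
Hypothesis Jok : stab_skew J.
Hypothesis Kok : stab_skew K.
Hypothesis JJ : forall x, J (J (lie v x)) = - lie v x.
Hypothesis KLL : forall x, K (lie v (lie v x)) = lie v x.

(** [J] squares to -1 on the tangent space, which is the image of [ad v]. *)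
Lemma JJm x : x \in m -> J (J x) = - x.
Proof. by case/mspace_imgP => y _ ->. Qed.

Lemma KL x : K (lie v x) = prm x.
Proof.
rewrite -lie_v_pr_m; have [/mspace_imgP [y _ ->] _] := pr_mem x.
by rewrite KLL.
Qed.

Local Notation A x y := (prm (lie x y)).
Local Notation B x y := (K (lie x (lie v y))).

(** [ad v] maps both sides to the same element, by the Leibniz rule. *)
Lemma BA x y : B x y - B y x = A x y.
Proof.
rewrite -linearB /= -KL [lie v (lie x y)]lie_derivation [lie (lie v x) y]lieC.
by congr (K _); rewrite addrC.
Qed.

(** [A x] and [- B x] are adjoint for the symplectic form. *)
Lemma omega_A x y z : y \in m -> omega phi (A x y) z = - omega phi y (B x z).
Proof.
move=> ym; have [_ Ks _] := Kok; rewrite !omegaE lie_v_pr_m.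
rewrite -[in RHS]Ks ?opprK KL // (pr_m_id ym) killing_skew.
by rewrite [lie x y]lieC killingNl opprK killing_lie.
Qed.

Lemma omega_B x y z : z \in m -> omega phi (B x y) z = - omega phi y (A x z).
Proof. by move=> zm; rewrite omegaC [in RHS]omegaC omega_A // opprK. Qed.

Lemma sandwich_linear (S P Q : 'End(g)) : linear (fun x => (S \o ad (P x) \o Q)%VF).
Proof.
move=> c x x'; apply/lfunP => y.
by rewrite add_lfunE scale_lfunE !comp_lfunE !adE linearP lieDl lieZl linearP.
Qed.

Definition sandwich (S P Q : 'End(g)) : 'Hom(g, 'End(g)) :=
  linfun (HB.pack (fun x => (S \o ad (P x) \o Q)%VF)
    (GRing.isLinear.Build _ _ _ _ _ (sandwich_linear S P Q)) : {linear g -> 'End(g)}).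

Lemma sandwichE S P Q x y : sandwich S P Q x y = S (lie (P x) (Q y)).
Proof. by rewrite lfunE /= !comp_lfunE adE. Qed.

(** [A] is projected onto the bilinear maps that commute with [J] in [y] and are
    conjugate linear in [x], and [B] onto those that commute with [J] in [y] and
    are complex linear in [x]; the factor [4^-1] normalizes both projections. *)
Definition chern_lfun : 'Hom(g, 'End(g)) := 4^-1 *:
  (sandwich prm \1 \1 - sandwich J \1 J + sandwich J J \1 + sandwich prm J J
   + (sandwich K \1 (ad v) - sandwich (J \o K) \1 (ad v \o J)
      - sandwich (J \o K) J (ad v) - sandwich K J (ad v \o J)))%VF.

Lemma chern_lfunE x y : chern_lfun x y = 4^-1 *:
  (A x y - J (lie x (J y)) + J (lie (J x) y) + A (J x) (J y)
   + (B x y - J (B x (J y)) - J (B (J x) y) - B (J x) (J y))).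
Proof.
by rewrite /chern_lfun !(scale_lfunE, add_lfunE, opp_lfunE) !sandwichE !(comp_lfunE, id_lfunE, adE).
Qed.

Lemma chern_lfun_mem x y : chern_lfun x y \in m.
Proof.
have am w : prm w \in m by case: (pr_mem w).
have jm w : J w \in m by apply: stab_skew_mem.
have km w : K w \in m by apply: stab_skew_mem.
by rewrite chern_lfunE; apply: memvZ; do !apply: memvD; rewrite ?memvN.
Qed.

Lemma chern_lfun_lie h x y : h \in st ->
  lie h (chern_lfun x y) = chern_lfun (lie h x) y + chern_lfun x (lie h y).
Proof.
move=> hs; have [Jc _ _] := Jok; have [Kc _ _] := Kok.
have hv : lie h v = 0 by rewrite lieC (stabE hs) oppr0.
have JD := lfunD J; have KD := lfunD K; have PD := lfunD prm.
rewrite !chern_lfunE linearZ /= -scalerDr; congr (_ *: _).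
rewrite !lieDr !lieNr -!(Jc _ _ hs) -!(Kc _ _ hs).
rewrite -!(pr_m_lie _ hs).
rewrite ![lie h (lie _ _)]lie_derivation.
rewrite !hv !lie0l !add0r.
rewrite -!(Jc _ _ hs).
rewrite !PD !KD !JD.
apply: vect_eqP => f; have fD := scalarD f; have fN := scalarN f.
rewrite !(fD, fN).
ring.
Qed.

Lemma JJ_pr w : J (J w) = - prm w.
Proof. by rewrite -[J w](stab_skew_pr Jok) JJm // (pr_mem w).1. Qed.

Lemma pr_K w : prm (K w) = K w.
Proof. by rewrite pr_m_id // stab_skew_mem. Qed.

Lemma chern_lfun_J x y : y \in m -> chern_lfun x (J y) = J (chern_lfun x y).
Proof.
move=> ym; have JD := lfunD J; have JN := lfunN J.
rewrite !chern_lfunE [J (_ *: _)]linearZ /=; congr (_ *: _).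
rewrite !JD !JN !(stab_skew_pr Jok) !JJ_pr !pr_K (pr_m_id ym).
rewrite !lieNr (lfunN prm) !(lfunN K) !JN.
apply: vect_eqP => f; have fD := scalarD f; have fN := scalarN f.
by rewrite !(fD, fN); ring.
Qed.

Lemma chern_lfun_torsion x y : x \in m -> y \in m ->
  torsion phi chern_lfun x y = nijenhuis phi J x y.
Proof.
move=> xm ym; rewrite /torsion /nijenhuis !chern_lfunE !(stab_skew_pr Jok).
have Byx u w : B w u = B u w - A u w by rewrite -BA opprB addrC subrK.
rewrite [B y x]Byx [B y (J x)]Byx [B (J y) x]Byx [B (J y) (J x)]Byx.
rewrite [lie y x]lieC [lie y (J x)]lieC [lie (J y) x]lieC [lie (J y) (J x)]lieC.
have JD := lfunD J; have JN := lfunN J.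
rewrite !(lfunN prm) !JD !JN !(stab_skew_pr Jok).
apply: vect_eqP => f; have fD := scalarD f; have fN := scalarN f.
have fZ := scalarZ f.
rewrite !(fD, fN, fZ).
by lra.
Qed.

Lemma chern_lfun_omega x y z : y \in m -> z \in m ->
  omega phi (chern_lfun x y) z + omega phi y (chern_lfun x z) = 0.
Proof.
move=> ym zm.
have jm w : J w \in m by apply: stab_skew_mem.
have oDl u w t : omega phi (u + w) t = omega phi u t + omega phi w t.
  by rewrite !omegaE linearD killingDl.
have oNl u t : omega phi (- u) t = - omega phi u t.
  by rewrite !omegaE linearN killingNl.
have oZl c u t : omega phi (c *: u) t = c * omega phi u t.
  by rewrite !omegaE linearZ killingZl.
have oDr u w t : omega phi t (u + w) = omega phi t u + omega phi t w.
  by rewrite !omegaE killingDr.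
have oNr u t : omega phi t (- u) = - omega phi t u by rewrite !omegaE killingNr.
have oZr c u t : omega phi t (c *: u) = c * omega phi t u by rewrite !omegaE killingZr.
have oJ := stab_skew_omega Jok.
rewrite !chern_lfunE oZl oZr -mulrDr; apply/eqP; rewrite mulf_eq0; apply/orP; right; apply/eqP.
rewrite !(oDl, oNl, oDr, oNr) -![J (lie _ _)](stab_skew_pr Jok).
rewrite !oJ !omega_A // !omega_B // !oJ.
ring.
Qed.

Lemma chern_connectionP : chern_connection phi J chern_lfun.
Proof.
split=> [|x y z _ ym zm|x y _ ym|x y xm ym].
- by split=> [x y _ _|h x y hs _ _]; [exact: chern_lfun_mem | exact: chern_lfun_lie].
- exact: chern_lfun_omega.
- exact: chern_lfun_J.
- exact: chern_lfun_torsion.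
Qed.

End ChernConnection.

Section ChernRicci.
Variables (R : realType) (g : lieAlgType R) (h0 : {vspace g}) (phi : hdual h0).
Implicit Types (x y z u h : g).

Local Notation v := (orbit_pt phi).
Local Notation m := (mspace phi).
Local Notation st := (stab phi).

Hypothesis m_st : (m :&: st = 0)%VS.
Variable J : 'End(g).
Hypothesis Jok : stab_skew phi J.

Let Jm x : J x \in m. Proof. exact: stab_skew_mem. Qed.

(** Every [w] in [mspace] is a bracket [lie v w'], so by equivariance [D w] is
    the commutator of [ad v] and [D w'], and [ad v] commutes with [J]. *)
Lemma trace_J_connection (D : 'Hom(g, 'End(g))) w : chern_connection phi J D ->
  w \in m -> trace_on m (fun z => J (D w z)) = 0.
Proof.
case=> [[Dm Dh] _ DJ _] /(mspace_imgP m_st)[w' w'm ->].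
have [Jc _ _] := Jok; have vs := stab_v phi.
have -> : trace_on m (fun z => J (D (lie v w') z)) =
    trace_on m (J \o (lie v \o D w')) - trace_on m ((J \o D w') \o lie v).
  rewrite -trace_onN -trace_onD; apply: eq_trace_on => z zm /=.
  by rewrite -linearB; congr (J _); rewrite (Dh _ _ _ vs w'm zm) addrK.
rewrite [X in _ - X]trace_onC => [|z zm|z zm] /=; last first.
- exact: mspace_lie_v.
- exact: Jm.
apply/eqP; rewrite subr_eq0; apply/eqP/eq_trace_on => z zm /=.
by rewrite Jc.
Qed.

(** The commutator [[D x, D y]] contributes nothing since [D x] and [D y] commute
    with [J], and the term [D [x, y]] nothing by [trace_J_connection]. *)
Lemma chern_ricciE (D : 'Hom(g, 'End(g))) x y : chern_connection phi J D ->
  x \in m -> y \in m ->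
  chern_ricci phi J D x y = - trace_on m (fun z => J (lie (pr_stab phi (lie x y)) z)).
Proof.
move=> Dchern xm ym; have [[Dm _] _ DJ _] := Dchern.
have trJDD u u' : u \in m -> u' \in m ->
    trace_on m (J \o (D u \o D u')) = trace_on m (J \o (D u' \o D u)).
  move=> um u'm; transitivity (trace_on m ((J \o D u) \o D u')) => //.
  rewrite trace_onC => [|z zm|z zm] /=; [|exact: Jm|exact: Dm].
  by apply: eq_trace_on => z zm /=; rewrite DJ ?Dm.
rewrite /chern_ricci /curvature; set w := pr_m phi _; set c := pr_stab phi _.
have wm : w \in m by rewrite memv_pi.
transitivity (trace_on m (J \o (D x \o D y)) - trace_on m (J \o (D y \o D x))
    - trace_on m (fun z => J (D w z)) - trace_on m (fun z => J (lie c z))).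
  rewrite -!trace_onN -!trace_onD; apply: eq_trace_on => z _ /=.
  by rewrite !lfunD !lfunN.
by rewrite (trJDD x y) // subrr (trace_J_connection Dchern wm) subrr sub0r.
Qed.

End ChernRicci.

(** * Odd functions of the orbit point *)

Section OddFunctions.
Variables (R : realType) (g : lieAlgType R) (h0 : {vspace g}) (phi : hdual h0).
Implicit Types (x y z u h : g).
Local Notation v := (orbit_pt phi).

Variables (a : nat -> R) (xs : seq g).
Hypothesis a_inj : injective a.
Hypothesis xs_full : <<xs>>%VS = {:g}%VS.
Hypothesis xs_eigen : forall x, x \in xs -> exists n, lie v (lie v x) = a n *: x.

Lemma eigen_bound : exists N, forall x, x \in xs ->
  exists2 n, (n < N)%N & lie v (lie v x) = a n *: x.
Proof.
elim: xs xs_eigen => [|x s IHs] sE; first by exists 0%N.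
have [|N NE] := IHs; first by move=> y ys; apply: sE; rewrite inE ys orbT.
have [n nE] := sE x (mem_head _ _); exists (maxn n.+1 N) => y.
rewrite inE => /orP[/eqP ->|/NE[i iN iE]]; [exists n | exists i] => //.
  by rewrite leq_max leqnn.
by rewrite leq_max iN orbT.
Qed.

(** [T] is [ad v] times an interpolation polynomial in the square of [ad v].
    Only finitely many of the values [a n] are eigenvalues, so the interpolation
    is over these; at the others there is no eigenvector to check. *)
Lemma odd_function (b : nat -> R) : exists2 T : 'End(g), stab_skew phi T &
  forall n x, lie v (lie v x) = a n *: x -> T x = b n *: lie v x.
Proof.
have [N NE] := eigen_bound; have [p pE] := interpolation b N a_inj.
pose f := (ad v \o ad v)%VF.
have fE x : f x = lie v (lie v x) by rewrite comp_lfunE !adE.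
have stab_comm h x : h \in stab phi -> lie h (lie v x) = lie v (lie h x).
  by move=> hs; rewrite lie_derivation [lie h v]lieC (stabE hs) oppr0 lie0l add0r.
have fcomm h x : h \in stab phi -> ad h (f x) = f (ad h x).
  by move=> hs; rewrite !fE !adE !stab_comm.
have TE x : (ad v \o poly_end f p)%VF x = lie v (poly_end f p x).
  by rewrite comp_lfunE adE.
exists (ad v \o poly_end f p)%VF.
  split=> [h x hs|x y|x].
  - rewrite !TE -!adE -(poly_end_comm _ _ (fun y => fcomm h y hs)) !adE.
    by rewrite stab_comm.
  - have fiter i u w : killing (iter i f u) w = killing u (iter i f w).
      elim: i u w => [|i IHi] u w //=.
      by rewrite fE !killing_skew opprK -fE IHi -iterSr.
    have fpoly u w : killing (poly_end f p u) w = killing u (poly_end f p w).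
      rewrite !poly_endE killingC !linear_sum; apply: eq_bigr => i _.
      by rewrite !linearZ /= killingC fiter.
    rewrite !TE killing_skew fpoly -!adE poly_end_comm // => u.
    by rewrite fcomm ?stab_v.
  - move/stabE => vx; rewrite TE (@poly_end_eigen _ _ f p 0 x) ?linearZ /= ?vx ?scaler0 //.
    by rewrite fE vx linear0 scale0r.
move=> n x xn; rewrite TE.
have [nN|Nn] := ltnP n N.
  by rewrite (@poly_end_eigen _ _ f p (a n) x) ?fE // pE // linearZ.
(* No interpolation node: the product of the node factors annihilates the whole
   space but acts on [x] by a nonzero scalar. *)
suff -> : x = 0 by rewrite !linear0 ?scaler0.
pose r := \prod_(i < N) ('X - (a i)%:P).
have r0 y : poly_end f r y = 0.
  move: y (memvf y); rewrite -xs_full; apply: span_ind => [|c y z y0 z0|y /NE[i iN yi]]; first exact: linear0.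
    by rewrite linearP /= y0 z0 scaler0 addr0.
  rewrite (@poly_end_eigen _ _ f r (a i) y) ?fE // horner_prod (bigD1 (Ordinal iN)) //=.
  by rewrite !hornerE subrr mul0r scale0r.
have /eqP := r0 x; rewrite (@poly_end_eigen _ _ f r (a n) x) ?fE // scaler_eq0 => /orP[|/eqP //].
rewrite horner_prod => /prodf_eq0[i _]; rewrite !hornerE subr_eq0 => /eqP /a_inj ni.
by move: Nn; rewrite ni leqNgt ltn_ord.
Qed.

End OddFunctions.

(** * A single painted node *)

Section PaintedNode.
Variables (R : realType) (g : lieAlgType R) (k p h0 : {vspace g}).
Variables (l : nat) (gam : l.-tuple (hdual h0)) (q : 'I_l).
Hypothesis cd : cartan_decomposition k p.
Hypothesis h0k : (h0 <= k)%VS.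
Hypothesis h0ab : lie_abelian h0.
Hypothesis h0cartan : cartan_subalgebra (cvspace h0).
Hypothesis gam_simple : simple_roots gam.
Hypothesis gam_vogan : vogan_painting k p gam [set q].

Implicit Types (x y t : g) (a : hdual h0).
Local Notation theta_eigen := (theta_eigen k p).
Local Notation phi := (fundamental_weight gam q).
Local Notation v := (orbit_pt phi).
Local Notation m := (mspace phi).
Local Notation st := (stab phi).
Local Notation c := (ip (tnth gam q) (tnth gam q) / 2).

Lemma weight_scale_gt0 : 0 < c.
Proof.
rewrite divr_gt0 // (ip_gt0 cd h0k) //.
by have [_ /(_ q)[]] := gam_simple.
Qed.

Lemma ip_phi_simple i : ip phi (tnth gam i) = (i == q)%:R * c.
Proof. by rewrite (ip_fundamental_weight cd h0k) ?(simple_free gam_simple). Qed.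

Lemma ip_phi n : ip phi (nat_comb gam n) = c * (n q)%:R.
Proof.
rewrite (ip_nat_comb cd h0k) (bigD1 q) //= big1 => [|i /negPf iq].
  by rewrite ip_phi_simple eqxx mul1r addr0 mulrC.
by rewrite ip_phi_simple iq mul0r mulr0.
Qed.

Lemma orbit_ptE : v = - hvec phi. Proof. by []. Qed.

Lemma orbit_pt_h0 : v \in h0. Proof. by rewrite orbit_ptE memvN hvec_h0. Qed.

Lemma h0_stab t : t \in h0 -> t \in st.
Proof. by move=> th; rewrite mem_stab h0ab ?orbit_pt_h0. Qed.

Lemma root_ad_v a z : root_vector a z ->
  lie v z.1 = - (ip phi a *: z.2) /\ lie v z.2 = ip phi a *: z.1.
Proof.
move/root_vectorP/(_ _ orbit_pt_h0); rewrite orbit_ptE linearN /= -(ip_wt cd h0k) ipC //.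
by rewrite !scaleNr opprK.
Qed.

Lemma root_ad_v2 a z : root_vector a z ->
  lie v (lie v z.1) = - ip phi a ^+ 2 *: z.1.
Proof.
by case/root_ad_v => -> zz; rewrite lieNr linearZ /= zz scalerA -expr2 scaleNr.
Qed.

(** [n] is, up to sign, the degree of the root in the grading by the painted
    node; negative roots are treated through conjugate root vectors. *)
Lemma root_degree a : is_root a -> exists n : nat,
  (ip phi a = c * n%:R \/ ip phi a = - (c * n%:R)) /\
  forall z, root_vector a z -> theta_eigen ((-1) ^+ n) z.
Proof.
move=> ra; have [_ _ roots] := gam_simple; have [n [an|an]] := roots a ra; exists (n q).
  rewrite an ip_phi; split=> [|z]; first by left.
  by apply: (theta_root cd h0k h0cartan gam_simple gam_vogan); rewrite -an; case: ra.
rewrite an; split=> [|z zn].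
  by right; rewrite -ip_phi (ipNr cd h0k).
have n0 : nat_comb gam n != 0 by rewrite -oppr_eq0 -an; case: ra.
have := root_vector_conj zn; rewrite opprK.
move/(theta_root cd h0k h0cartan gam_simple gam_vogan n0)/theta_eigen_conj.
by rewrite /cconj /= opprK -surjective_pairing.
Qed.

(** The stabilizer is spanned by [h0] and root vectors of degree 0, an even
    degree. *)
Lemma stab_sub_k : compact_stabilizer k phi.
Proof.
have [|xs stE Gxs] := weight_span cd h0k h0ab h0cartan (U := st).
  by move=> t x th xs; rewrite stab_lie // h0_stab.
rewrite /compact_stabilizer stE; apply/span_subvP => x /Gxs [|[a [z [ra az zx z2]]]].
  exact: (subvP h0k).
have [_ vz2] := root_ad_v az; move: vz2; rewrite (stabE z2) -zx => /esym/eqP.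
rewrite scaler_eq0 => /orP[/eqP a0|/eqP ->]; last exact: mem0v.
have [n [na nz]] := root_degree ra; have [z1 _] := nz _ az.
apply: (mem_cartan_k cd); rewrite z1; suff -> : n = 0%N by rewrite scale1r.
apply/eqP; move: na; rewrite a0 => -[] /eqP; rewrite eq_sym ?oppr_eq0 mulf_eq0;
  by rewrite (gt_eqF weight_scale_gt0) pnatr_eq0.
Qed.

Lemma mspace_cap_stab : (m :&: st = 0)%VS.
Proof.
apply/eqP; rewrite -subv0; apply/subvP => x; rewrite memv_cap => /andP[xm xs].
rewrite memv0; apply/contraT => x0; have xk := subvP stab_sub_k _ xs.
by case: cd => _ _ _ /(_ x xk x0); rewrite (mspaceE xm xs) ltxx.
Qed.

Definition ad_v2_eigen (n : nat) : R := - (c * n%:R) ^+ 2.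

Lemma ad_v2_eigen_inj : injective ad_v2_eigen.
Proof.
move=> n n' /oppr_inj /eqP; have c0 := weight_scale_gt0.
have cn j : 0 <= c * j%:R by rewrite mulr_ge0 ?ler0n // ltW.
rewrite eqrXn2 ?cn // => /eqP/(mulfI (lt0r_neq0 c0))/eqP.
by rewrite eqr_nat => /eqP.
Qed.

(** On the root planes of degree [n] and on [h0], where [n = 0]. *)
Lemma ad_v2_spectrum : exists2 xs : seq g, <<xs>>%VS = {:g}%VS &
  forall x, x \in xs -> exists n, lie v (lie v x) = ad_v2_eigen n *: x.
Proof.
have [|xs -> Gxs] := weight_span cd h0k h0ab h0cartan (U := {:g}).
  by move=> *; apply: memvf.
exists xs => // x /Gxs [xh|[a [z [ra az <- _]]]].
  by exists 0%N; rewrite (stabE (h0_stab xh)) linear0 /ad_v2_eigen mulr0 expr0n oppr0 scale0r.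
have [n [na _]] := root_degree ra; exists n; rewrite (root_ad_v2 az) /ad_v2_eigen.
by case: na => ->; rewrite ?sqrrN.
Qed.

Lemma ad_v_odd_function (b : nat -> R) : exists2 T : 'End(g), stab_skew phi T &
  forall n x, lie v (lie v x) = ad_v2_eigen n *: x -> T x = b n *: lie v x.
Proof.
have [xs xs_full xsE] := ad_v2_spectrum.
exact: odd_function ad_v2_eigen_inj xs_full xsE b.
Qed.

Lemma ad_v2_ind (P : g -> Prop) : P 0 -> (forall d x y, P x -> P y -> P (d *: x + y)) ->
  (forall n x, lie v (lie v x) = ad_v2_eigen n *: x -> P x) -> forall x, P x.
Proof.
move=> P0 PD Pe x; have [xs xs_full xsE] := ad_v2_spectrum.
move: x (memvf x); rewrite -xs_full; apply: span_ind => // x /xsE[n]; exact: Pe.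
Qed.

Lemma ad_v2_eq0 x : lie v (lie v x) = 0 -> lie v x = 0.
Proof.
move=> vvx; apply: (cartan_form_eq0 cd).
by rewrite (cartan_form_lie_h cd h0k) ?orbit_pt_h0 // vvx linear0 oppr0.
Qed.

(** The sign [eps] of the roots of degree [n]. *)
Definition degree_sign (n : nat) : R := - (-1) ^+ n.

(** On the part of degree [n], [J] is [eps_n / (c n)] times [ad v], whose square
    is [- (c n) ^ 2]. *)
Lemma acs_exists : exists2 J : 'End(g), stab_skew phi J &
  (forall x, J (J (lie v x)) = - lie v x) /\ canonical_acs k gam phi J.
Proof.
pose b n := degree_sign n / (c * n%:R).
have [J Jok JE] := ad_v_odd_function b; exists J => //; split.
  have [Jc _ _] := Jok; apply: ad_v2_ind => [|d x y Jx Jy|n x xn].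
  - by rewrite !linear0.
  - by rewrite !linearD !linearZ /= Jx Jy.
  rewrite Jc ?stab_v // (JE _ _ xn) linearZ /= linearZ /= xn linearZ /= (JE _ _ xn) !scalerA.
  have [n0|n0] := eqVneq n 0%N.
    have vx : lie v x = 0.
      by apply: ad_v2_eq0; rewrite xn n0 /ad_v2_eigen mulr0 expr0n oppr0 scale0r.
    by rewrite vx scaler0 oppr0.
  rewrite -scaleN1r; congr (_ *: _); rewrite /b /degree_sign /ad_v2_eigen.
  have sgn2 : (-1) ^+ n * (-1) ^+ n = 1 :> R by rewrite -expr2 sqrr_sign.
  rewrite -[in RHS]sgn2; have : c * n%:R != 0.
    by rewrite mulf_neq0 ?pnatr_eq0 // lt0r_neq0 ?weight_scale_gt0.
  by move: (c * n%:R) ((-1) ^+ n) => d e d0; field.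
move=> a [ra [n an]] pa x [z [w [za wa xzw]]].
have {x xzw} -> : x = z.1 + w.1 by have := congr1 (fun z : complexification g => z.1) xzw.
have phin : ip phi a = c * (n q)%:R by rewrite an ip_phi.
have xn : lie v (lie v (z.1 + w.1)) = ad_v2_eigen (n q) *: (z.1 + w.1).
  rewrite !lieDr (root_ad_v2 za) (root_ad_v2 wa) (ipNr cd h0k) sqrrN.
  by rewrite phin -scalerDr.
rewrite (JE _ _ xn) /b -phin; congr (_ / _ *: _).
have n0 : nat_comb gam n != 0 by rewrite -an; case: ra.
have eps_a z' : root_vector a z' -> theta_eigen ((-1) ^+ n q) z'.
  by rewrite an; apply: theta_root.
rewrite /eps /degree_sign -signr_odd; have [nodd|neven] := boolP (odd (n q)).
  rewrite asboolF ?expr1 ?opprK // => -[_ acomp]; have [_ [z' z'a z'0]] := ra.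
  have := acomp z' z'a; rewrite mem_cvspace => /andP[z1 z2].
  move/eqP: z'0; apply; apply: (theta_eigenN (k := k) (p := p) (oner_neq0 R)).
    by split; rewrite scale1r (cartan_inv_k cd).
  by have := eps_a z' z'a; rewrite -signr_odd nodd expr1.
rewrite asboolT ?expr0 //; split=> // z' /eps_a; rewrite -signr_odd (negPf neven).
case; rewrite expr0 !scale1r => z1 z2.
by rewrite mem_cvspace !(mem_cartan_k cd).
Qed.

(** An inverse of [ad v] on its image. *)
Lemma ad_v_inverse_exists : exists2 K : 'End(g), stab_skew phi K &
  forall x, K (lie v (lie v x)) = lie v x.
Proof.
have [K Kok KE] := ad_v_odd_function (fun n => (ad_v2_eigen n)^-1); exists K => //.
apply: ad_v2_ind => [|d x y Kx Ky|n x xn].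
- by rewrite !linear0.
- by rewrite !linearD !linearZ /= Kx Ky.
rewrite xn linearZ /= (KE _ _ xn) scalerA; have [n0|n0] := eqVneq n 0%N.
  rewrite ad_v2_eq0 ?scaler0 // xn n0 /ad_v2_eigen mulr0 expr0n oppr0 scale0r //.
rewrite divff ?scale1r // oppr_eq0 expf_eq0 /= mulf_neq0 ?pnatr_eq0 //.
by rewrite lt0r_neq0 ?weight_scale_gt0.
Qed.

Section Trace.
Variable J : 'End(g).
Hypothesis Jok : stab_skew phi J.
Local Notation F x := (trace_on m (fun z => J (lie x z))).

Lemma trace_J_linear d x y : F (d *: x + y) = d * F x + F y.
Proof.
rewrite -trace_onZ -trace_onD; apply: eq_trace_on => z _ /=.
by rewrite lieDl lieZl linearP.
Qed.

Lemma trace_J0 : F 0 = 0.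
Proof.
by have := trace_J_linear (-1) 0 0; rewrite scaler0 addr0 mulN1r addNr.
Qed.

Lemma trace_J_scale d x : F (d *: x) = d * F x.
Proof. by rewrite -[d *: x in LHS]addr0 trace_J_linear trace_J0 addr0. Qed.

Lemma trace_J_lie x y : x \in st -> y \in st -> F (lie x y) = 0.
Proof.
move=> xs ys; have [Jc _ _] := Jok.
have -> : F (lie x y) = trace_on m ((J \o lie x) \o lie y) - trace_on m (J \o (lie y \o lie x)).
  rewrite -trace_onN -trace_onD; apply: eq_trace_on => z _ /=.
  by rewrite lie_lieE linearB.
rewrite trace_onC => [|z zm|z zm] /=.
- apply/eqP; rewrite subr_eq0; apply/eqP/eq_trace_on => z zm /=.
  by rewrite [RHS]Jc.
- exact: stab_skew_mem.
- exact: mspace_lie.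
Qed.

(** For an unpainted simple root [gamma_i], a root vector [e] and its conjugate
    lie in the complexified stabilizer, so [h_(gamma_i)], which is proportional
    to their bracket, is killed by the functional.  The orthogonal of [phi] is
    spanned by these roots. *)
Lemma trace_J_orth t : t \in h0 -> killing v t = 0 -> F t = 0.
Proof.
move=> th vt; pose psi := killing_functional h0 t.
have psit : hvec psi = t := hvec_functional cd h0k th.
have [gam_basis gam_root _] := gam_simple.
have [u psiE] : exists u : 'I_l -> R, psi = \sum_i u i *: tnth gam i.
  exists (coord gam ^~ psi); rewrite {1}(coord_basis gam_basis (memvf psi)).
  by apply: eq_bigr => i _; rewrite (tnth_nth 0).
have uq : u q = 0.
  have : ip phi psi = 0 by rewrite ipE // psit -[hvec phi]opprK -orbit_ptE
      killingNl vt !oppr0.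
  rewrite psiE (ip_sumr cd h0k) (bigD1 q) //= big1 => [|i /negPf iq].
    rewrite ip_phi_simple eqxx mul1r addr0 => /eqP.
    by rewrite mulf_eq0 (gt_eqF weight_scale_gt0) orbF => /eqP.
  by rewrite ip_phi_simple iq mul0r mulr0.
rewrite -psit psiE (hvec_sum cd h0k).
elim/big_rec: _ => [|i x _ Fx]; first exact: trace_J0.
rewrite trace_J_linear Fx addr0.
have [->|iq] := eqVneq i q; first by rewrite uq mul0r.
suff -> : F (hvec (tnth gam i)) = 0 by rewrite mulr0.
have [gi0 [e ei e0]] := gam_root i.
have e20 := root_vector2_neq0 gi0 ei e0.
have [] := root_ad_v ei; rewrite ip_phi_simple (negPf iq) mul0r !scale0r oppr0 => ve1 ve2.
have := trace_J_lie (x := e.1) (y := e.2); rewrite !mem_stab ve1 ve2 eqxx => /(_ isT isT).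
rewrite (lie_root_conj cd h0k h0cartan ei) trace_J_scale.
move/eqP; rewrite mulf_eq0 => /orP[|/eqP //].
have [_ e2] := theta_simple cd gam_vogan ei.
have := cartan_form_gt0 cd e20.
by rewrite /cartan_form e2 (negPf iq) expr0 scale1r => /gt_eqF ->.
Qed.

(** The functional is invariant under the stabilizer, hence vanishes on its
    root vectors, like the functional that [v] represents. *)
Lemma trace_J_stab : exists mu, forall x, x \in st -> F x = mu * killing v x.
Proof.
have vv0 : killing v v != 0.
  rewrite lt_eqF // (killing_h0_lt0 cd h0k) ?orbit_pt_h0 //.
  apply/eqP => v0; have := ip_phi_simple q; rewrite eqxx mul1r ipE -[hvec phi]opprK -orbit_ptE v0.
  by rewrite oppr0 killing0l oppr0 => /esym/eqP; rewrite (gt_eqF weight_scale_gt0).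
exists (F v / killing v v).
have [|xs stE Gxs] := weight_span cd h0k h0ab h0cartan (U := st).
  by move=> t x th xs; rewrite stab_lie // h0_stab.
rewrite stE; apply: span_ind => [|d x y Fx Fy|x /Gxs[xh|[a [z [[a0 _] az zx z2]]]]].
- by rewrite trace_J0 killing0r mulr0.
- by rewrite trace_J_linear Fx Fy killingDr killingZr; ring.
- have := trace_J_orth (t := - (killing v x / killing v v) *: v + x).
  rewrite memvD ?memvZ ?orbit_pt_h0 // killingDr killingZr mulNr divfK // addNr.
  move=> /(_ isT erefl); rewrite trace_J_linear => /eqP.
  by rewrite mulNr addrC subr_eq0 => /eqP ->; ring.
have [t th at0] := wt_neq0 a0; move/root_vectorP: az => /(_ t th)[_ tz].
have xE : x = - (wt a t)^-1 *: lie t z.2.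
  by rewrite tz scalerN scaleNr opprK scalerA mulVf // scale1r zx.
have tzF := trace_J_lie (h0_stab th) z2.
rewrite xE trace_J_scale tzF killingZr -killing_lie (stabE (h0_stab th)).
by rewrite killing0l !mulr0.
Qed.

End Trace.

Lemma phi_dominant : dominant gam phi.
Proof.
by move=> a [_ [n ->]]; rewrite ip_phi mulr_ge0 ?ler0n // ltW ?weight_scale_gt0.
Qed.

(** The tangent component of [[x, y]] is orthogonal to [v], so [killing v] sees
    only the stabilizer component. *)
Lemma phi_special : special k gam phi.
Proof.
have m_st := mspace_cap_stab.
have [J Jok [JJ Jacs]] := acs_exists; have [K Kok KLL] := ad_v_inverse_exists.
have [mu muE] := trace_J_stab Jok.
have Dchern := chern_connectionP m_st Jok Kok JJ KLL.
exists (- mu); split; [exact: phi_dominant | exact: stab_sub_k|].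
exists J, (chern_lfun phi J K); split=> // x y xm ym.
have [prm prs] := pr_mem phi (lie x y).
rewrite (chern_ricciE m_st Jok Dchern) // muE // mulNr; congr (- (_ * _)).
rewrite /omega [in RHS](pr_add m_st (lie x y)) killingDr (mspaceE prm) ?stab_v //.
by rewrite add0r.
Qed.

End PaintedNode.

Theorem proposition8p4 (R : realType) (g : lieAlgType R)
    (k p h0 : {vspace g}) (l : nat) (gam : l.-tuple (hdual h0))
    (painted : {set 'I_l}) (q : 'I_l) :
  lie_semisimple g ->
  cartan_decomposition k p ->
  maximal_abelian_in k h0 ->
  cartan_subalgebra (cvspace h0) ->
  simple_roots gam ->
  vogan_painting k p gam painted ->
  painted = [set q] ->
  special k gam (fundamental_weight gam q).
Proof.
move=> _ cd [h0k h0ab _] h0cartan gam_simple gam_vogan paintedE; subst painted.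
exact: phi_special cd h0k h0ab h0cartan gam_simple gam_vogan.
Qed.
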